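(* Consider either the multi-indexed Laguerre case (L) or the multi-indexed Jacobi case (J), with multi-index $\mathcal D$, integer $\mathcal N\ge1$, and the associated $\widetilde{\mathcal N}\times\widetilde{\mathcal N}$ matrix $\mathcal M$ and real vector space $\bm V\subset\mathbb C^{\widetilde{\mathcal N}}$ with bilinear form $({\rm v},{\rm w})=\sum_{m=1}^{\widetilde{\mathcal N}}{\rm v}_m{\rm w}_m$ (all defined in the context). Eigenvectors of $\mathcal M$ belonging to different eigenvalues are orthogonal with respect to this form: if ${\rm v},{\rm w}\in\bm V$ satisfy $\mathcal M{\rm v}=\alpha{\rm v}$, $\mathcal M{\rm w}=\beta{\rm w}$ with $\alpha\ne\beta$, then $({\rm v},{\rm w})=0$.
   Context: **Multi-index and parameters.** $\mathcal D=\mathcal D^{\rm I}\cup\mathcal D^{\rm II}$, $\mathcal D^{\rm I}=\{d_1^{\rm I}<\dots<d_M^{\rm I}\}$, $\mathcal D^{\rm II}=\{d_1^{\rm II}<\dots<d_N^{\rm II}\}$, positive integers, $M,N\ge0$, $M+N\ge1$ (the labels I and II are part of the data). Real parameters: $g$ in case L, with $g>\max\{N+\frac32,\,d_j^{\rm II}+\frac12\}$; $(g,h)$ in case J, with $g>\max\{N+2,\,d_j^{\rm II}+\frac12\}$, $h>\max\{M+2,\,d_j^{\rm I}+\frac12\}$. **Polynomials.** $P_n=L_n^{(g-1/2)}$ (Laguerre, L), $P_n=P_n^{(g-1/2,h-1/2)}$ (Jacobi, J). For an integer ${\rm v}\ge 0$ put - L: $\mu^{\rm I}_{\rm v}(\eta)=e^{\eta}L^{(g-1/2)}_{\rm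 v}(-\eta)$, $\ \mu^{\rm II}_{\rm v}(\eta)=\eta^{1/2-g}L^{(1/2-g)}_{\rm v}(\eta)$; - J: $\mu^{\rm I}_{\rm v}(\eta)=\bigl(\frac{1+\eta}2\bigr)^{1/2-h}P^{(g-1/2,1/2-h)}_{\rm v}(\eta)$, $\ \mu^{\rm II}_{\rm v}(\eta)=\bigl(\frac{1-\eta}2\bigr)^{1/2-g}P^{(1/2-g,h-1/2)}_{\rm v}(\eta)$. With ${\rm W}[f_1,\dots,f_r]=\det(d^{i-1}f_j/d\eta^{i-1})_{1\le i,j\le r}$, define the polynomials $$\Xi_{\mathcal D}(\eta)={\rm W}[\mu^{\rm I}_{d^{\rm I}_1},\dots,\mu^{\rm I}_{d^{\rm I}_M},\mu^{\rm II}_{d^{\rm II}_1},\dots,\mu^{\rm II}_{d^{\rm II}_N}]\times\begin{cases}\eta^{(M+g-\frac12)N}e^{-M\eta}&\text{L}\\ \bigl(\frac{1-\eta}2\bigr)^{(M+g-\frac12)N}\bigl(\frac{1+\eta}2\bigr)^{(N+h-\frac12)M}&\text{J}\end{cases}$$ $$P_{\mathcal D,n}(\eta)={\rm W}[\mu^{\rm I}_{d^{\rm I}_1},\dots,\mu^{\rm I}_{d^{\rm I}_M},\mu^{\rm II}_{d^{\rm II}_1},\dots,\mu^{\rm II}_{d^{\rm II}_N},P_n]\times\begin{cases}\eta^{(M+g+\frac12)N}e^{-M\eta}&\text{L}\\ \bigl(\frac{1-\eta}2\bigr)^{(M+g+\frac12)N}\bigl(\frac{1+\eta}2\bigr)^{(N+h+\frac12)M}&\text{J}\end{cases}$$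 and $\ell_{\mathcal D}=\sum_j d_j^{\rm I}-\frac12M(M-1)+\sum_j d_j^{\rm II}-\frac12N(N-1)+MN$, $\ \widetilde{\mathcal N}=\ell_{\mathcal D}+\mathcal N$. **Differential operator.** $\mathcal E(n)=4n$ (L), $\mathcal E(n)=4n(n+g+h)$ (J). $c_2(\eta)=\eta$ (L), $1-\eta^2$ (J). Put $c_1(\eta;g)=g+\frac12-\eta$ (L), $c_1(\eta;g,h)=h-g-(g+h+1)\eta$ (J). Let $C_1$ be $c_1$ with parameters shifted to $g+M-N$ (L), $(g+M-N,h-M+N)$ (J), and $C_1^-$ be $c_1$ with parameters $g+M-N-1$ (L), $(g+M-N-1,h-M+N-1)$ (J). Then $$\widetilde{\mathcal H}_{\mathcal D}=-4\Bigl(c_2\frac{d^2}{d\eta^2}+\Bigl(C_1-2c_2\frac{\Xi_{\mathcal D}'}{\Xi_{\mathcal D}}\Bigr)\frac{d}{d\eta}+c_2\frac{\Xi_{\mathcal D}''}{\Xi_{\mathcal D}}-C_1^-\frac{\Xi_{\mathcal D}'}{\Xi_{\mathcal D}}\Bigr).$$ **Matrices.** Let $\eta_1,\dots,\eta_{\widetilde{\mathcal N}}$ be the zeros of $P_{\mathcal D,\mathcal N}$. The sinusoidal coordinate is $\eta(x)=x^2$ (L), $\eta(x)=\cos 2x$ (J); choose $x_n\in\mathbb C$ with $\eta(x_n)=\eta_n$ and write $\dot\eta(x)=d\eta/dx$ (so $\dot\eta(x_n)^2=4c_2(\eta_n)$). Define $$\widetilde{\mathcal M}_{nm}=\frac{\Bigl[\bigl(\widetilde{\mathcal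 H}_{\mathcal D}-\mathcal E(\mathcal N)\bigr)\prod_{j\ne m}(\eta-\eta_j)\Bigr]_{\eta=\eta_n}}{\prod_{j\ne n}(\eta_n-\eta_j)},\qquad \mathcal M_{nm}=-\frac{\dot\eta(x_m)}{\dot\eta(x_n)}\widetilde{\mathcal M}_{nm},$$ i.e. $\mathcal M=-D^{-1}\widetilde{\mathcal M}D$ with $D={\rm diag}(\dot\eta(x_1),\dots,\dot\eta(x_{\widetilde{\mathcal N}}))$. **Vector spaces.** $P_{\mathcal D,\mathcal N}$ has real coefficients; let $n\mapsto\bar n$ be the involution of indices with $\eta_{\bar n}=\overline{\eta_n}$ ($\bar n=n$ for real zeros). Put $\widetilde{\bm V}=\{\tilde{\rm v}\in\mathbb C^{\widetilde{\mathcal N}}:\overline{\tilde{\rm v}_n}=\tilde{\rm v}_{\bar n}\ \forall n\}$, a vector space over $\mathbb R$, and $\bm V=\{D^{-1}\tilde{\rm v}:\tilde{\rm v}\in\widetilde{\bm V}\}$. **Standing assumption.** $P_{\mathcal D,\mathcal N}$ has degree exactly $\widetilde{\mathcal N}$, its zeros are pairwise distinct, none equals $0$ (L) or $\pm1$ (J), and none is a zero of $\Xi_{\mathcal D}$. *)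

(* Defs.v *)
From HB Require Import structures.
From mathcomp Require Import all_boot all_order all_algebra.
From mathcomp Require Import all_classical all_reals all_analysis.
From mathcomp Require Import complex.
Set Implicit Arguments.
Unset Strict Implicit.
Unset Printing Implicit Defensive.
Import Order.TTheory GRing.Theory Num.Theory.
Import numFieldNormedType.Exports.
Local Open Scope classical_set_scope.
Local Open Scope ring_scope.

Section ClassicalPolynomials.
Variable R : realType.

(* Rising factorial (a)_n. *)
Definition pochhammer (a : R) (n : nat) : R := \prod_(i < n) (a + i%:R).

(* The coefficients (a + k + 1)_(n - k) / (n - k)! = binom(n + a, n - k) make
   sense for every real a, including the negative parameters needed below;
   the same remark applies to [jacobi]. *)
Definition laguerre (n : nat) (a : R) : {poly R} :=
  \sum_(k < n.+1)
    ((-1) ^+ k * pochhammer (a + k%:R + 1) (n - k) / (k`! * (n - k)`!)%:R)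
      *: 'X^k.

(* P_n^(a,b)(y) = (a+1)_n/n! * 2F1(-n, n+a+b+1; a+1; (1-y)/2), with the
   denominators (a+1)_k cancelled. *)
Definition jacobi (n : nat) (a b : R) : {poly R} :=
  \sum_(k < n.+1)
    (pochhammer (n%:R + a + b + 1) k * pochhammer (a + k%:R + 1) (n - k)
       / (k`! * (n - k)`!)%:R)
      *: (2^-1 *: ('X - 1)) ^+ k.

End ClassicalPolynomials.

Section ComplexTrigonometry.
Variable R : realType.
Local Open Scope complex_scope.

Definition cexp (z : R[i]) : R[i] :=
  (expR (complex.Re z))%:C * (cos (complex.Im z) +i* sin (complex.Im z)).

Definition ccos (z : R[i]) : R[i] := (cexp ('i * z) + cexp (- ('i * z))) / 2.

End ComplexTrigonometry.

(* The two families together with their real parameters: g, resp. g and h. *)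
Inductive system (R : Type) : Type :=
  | Lag of R
  | Jac of R & R.

Section MultiIndexed.
Variable R : realType.
Implicit Types (s : system R) (dI dII : seq nat).

Definition wronskian (fs : seq (R -> R)) (y : R) : R :=
  \det (\matrix_(i < size fs, j < size fs)
          derive1n i (nth (fun=> 0) fs j) y).

(* A multi-index is given by its increasing lists dI (type I) and dII (type II)
   of positive integers; M = size dI and N = size dII. *)
Definition multi_index dI dII : Prop :=
  [/\ sorted ltn dI, sorted ltn dII, all (leq 1) dI, all (leq 1) dII
    & (1 <= size dI + size dII)%N].

Definition admissible s dI dII : Prop :=
  match s with
  | Lag g =>
      (size dII)%:R + 3 / 2 < g /\ (forall d, d \in dII -> d%:R + 2^-1 < g)
  | Jac g h =>
      [/\ (size dII)%:R + 2 < g, forall d, d \in dII -> d%:R + 2^-1 < g,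
          (size dI)%:R + 2 < h & forall d, d \in dI -> d%:R + 2^-1 < h]
  end.

(* The interval of R on which the real powers below are smooth and nonzero. *)
Definition domain s : set R :=
  match s with
  | Lag _ => [set y | 0 < y]
  | Jac _ _ => [set y | -1 < y < 1]
  end.

Definition base_poly s (n : nat) : {poly R} :=
  match s with
  | Lag g => laguerre n (g - 2^-1)
  | Jac g h => jacobi n (g - 2^-1) (h - 2^-1)
  end.

Definition muI s (v : nat) (y : R) : R :=
  match s with
  | Lag g => expR y * (laguerre v (g - 2^-1)).[- y]
  | Jac g h =>
      ((1 + y) / 2) `^ (2^-1 - h) * (jacobi v (g - 2^-1) (2^-1 - h)).[y]
  end.

Definition muII s (v : nat) (y : R) : R :=
  match s with
  | Lag g => y `^ (2^-1 - g) * (laguerre v (2^-1 - g)).[y]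
  | Jac g h =>
      ((1 - y) / 2) `^ (2^-1 - g) * (jacobi v (2^-1 - g) (h - 2^-1)).[y]
  end.

Definition seeds s dI dII : seq (R -> R) :=
  [seq muI s d | d <- dI] ++ [seq muII s d | d <- dII].

(* The prefactor of the Wronskian, with e = -1/2 for Xi and e = 1/2 for P. *)
Definition prefactor s dI dII (e y : R) : R :=
  let M : R := (size dI)%:R in
  let N : R := (size dII)%:R in
  match s with
  | Lag g => y `^ ((M + g + e) * N) * expR (- (M * y))
  | Jac g h =>
      ((1 - y) / 2) `^ ((M + g + e) * N) * ((1 + y) / 2) `^ ((N + h + e) * M)
  end.

(* The polynomial agreeing with f on A (unique as soon as A is infinite).  If
   there is none the value is 0, which cannot occur under [regular] below. *)
Definition poly_of (A : set R) (f : R -> R) : {poly R} :=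
  xget 0 [set p : {poly R} | forall y, A y -> p.[y] = f y].

Definition Xi s dI dII : {poly R} :=
  poly_of (domain s) (fun y =>
    wronskian (seeds s dI dII) y * prefactor s dI dII (- 2^-1) y).

Definition multi_poly s dI dII (n : nat) : {poly R} :=
  poly_of (domain s) (fun y =>
    wronskian (rcons (seeds s dI dII) (fun t => (base_poly s n).[t])) y
      * prefactor s dI dII 2^-1 y).

(* No truncation occurs: dI and dII are increasing lists of positive integers. *)
Definition ell dI dII : nat :=
  ((sumn dI - (size dI * (size dI).-1)./2)
   + (sumn dII - (size dII * (size dII).-1)./2)
   + size dI * size dII)%N.

Definition energy s (n : nat) : R :=
  match s with
  | Lag _ => 4 * n%:R
  | Jac g h => 4 * n%:R * (n%:R + g + h)
  end.

Definition c2 s : {poly R} :=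
  match s with
  | Lag _ => 'X
  | Jac _ _ => 1 - 'X^2
  end.

Definition c1 s : {poly R} :=
  match s with
  | Lag g => (g + 2^-1)%:P - 'X
  | Jac g h => (h - g)%:P - (g + h + 1) *: 'X
  end.

Definition shift_params s (a b : R) : system R :=
  match s with
  | Lag g => Lag (g + a)
  | Jac g h => Jac (g + a) (h + b)
  end.

Local Notation C := R[i].
Local Notation toC := (map_poly (real_complex R)).

(* The value at z of the operator H~_D applied to the polynomial p; it is only
   meaningful where Xi does not vanish. *)
Definition Htilde s dI dII (p : {poly C}) (z : C) : C :=
  let M : R := (size dI)%:R in
  let N : R := (size dII)%:R in
  let X := toC (Xi s dI dII) in
  let c := (toC (c2 s)).[z] in
  let C1 := (toC (c1 (shift_params s (M - N) (N - M)))).[z] in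
  let C1m := (toC (c1 (shift_params s (M - N - 1) (N - M - 1)))).[z] in
  let X1 := X^`().[z] / X.[z] in
  let X2 := X^`(2).[z] / X.[z] in
  - 4 * (c * p^`(2).[z] + (C1 - 2 * c * X1) * p^`().[z]
         + (c * X2 - C1m * X1) * p.[z]).

Definition sinusoidal s (x : C) : C :=
  match s with
  | Lag _ => x ^+ 2
  | Jac _ _ => ccos (2 * x)
  end.

(* Complex derivative of the sinusoidal coordinate. *)
Definition sinusoidal_dot s : C -> C :=
  @derive1 C C^o (sinusoidal s).

Section Matrices.
Variables (s : system R) (dI dII : seq nat) (n0 : nat).
Local Notation Nt := (ell dI dII + n0)%N.
Variables (eta x : 'I_Nt -> C).

Definition Mtilde : 'M[C]_Nt :=
  \matrix_(n, m)
    let p : {poly C} := \prod_(j | j != m) ('X - (eta j)%:P) in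
    (Htilde s dI dII p (eta n) - real_complex R (energy s n0) * p.[eta n])
      / \prod_(j | j != n) (eta n - eta j).

Definition Mmx : 'M[C]_Nt :=
  \matrix_(n, m)
    - (sinusoidal_dot s (x m) / sinusoidal_dot s (x n) * Mtilde n m).

Definition Dmx : 'M[C]_Nt := diag_mx (\row_n sinusoidal_dot s (x n)).

(* Standing assumption, where eta lists the zeros of P_{D,n0}. *)
Definition regular : Prop :=
  let P := multi_poly s dI dII n0 in
  [/\ size P = Nt.+1,
      toC P = real_complex R (lead_coef P) *: \prod_n ('X - (eta n)%:P),
      injective eta,
      forall n, match s with
                | Lag _ => eta n != 0
                | Jac _ _ => (eta n != 1) && (eta n != -1)
                end
    & forall n, ~~ root (toC (Xi s dI dII)) (eta n)].

Variable bar : 'I_Nt -> 'I_Nt.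

Definition Vtilde : set 'cV[C]_Nt :=
  [set v | forall n, conjc (v n 0) = v (bar n) 0].

Definition Vspace : set 'cV[C]_Nt := [set invmx Dmx *m v | v in Vtilde].

End Matrices.

End MultiIndexed.

Definition bilin (A : pzRingType) (n : nat) (v w : 'cV[A]_n) : A :=
  \sum_m v m 0 * w m 0.

(* Main.v *)
(** The matrix M is symmetric, whence the orthogonality.  At a zero of P = P_(D,N)
the eigenvalue equation of H~_D reduces to
  c_2 P'' + (C_1 - 2 c_2 Xi'/Xi) P' = 0,
and with it every off-diagonal entry of M~ collapses to
8 c_2(eta_n) / (eta_n - eta_m)^2; conjugating by D makes this
2 eta'(x_n) eta'(x_m) / (eta_n - eta_m)^2 up to sign.

The displayed equation is a form of Crum's theorem.  Let W be the Wronskian of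
solutions f_j of c_2 f'' + c_1 f' = lam_j f, and U that of the f_j and one more
solution.  Differentiating the equation k times shows that row k of the
Wronskian matrix, with its columns multiplied by the lam_j, is a combination of
rows k, k + 1 and k + 2.  Replacing the rows one at a time by these products and
adding up the determinants gives (sum lam_j) W, hence second-order identities
for W and U separately; a three-term Pluecker relation couples them into an
identity that is bilinear in W and U and needs no division by W.  Passing from
W and U to the polynomials Xi and P only shifts the first-order coefficient, and
polynomial identities on a real interval persist at complex zeros. *)

Require Import Defs.
From HB Require Import structures.
From mathcomp Require Import all_boot all_order all_algebra.
From mathcomp Require Import all_classical all_reals all_analysis.
From mathcomp Require Import complex.
From mathcomp Require Import perm zify ring lra.
Set Implicit Arguments.
Unset Strict Implicit.
Unset Printing Implicit Defensive.
Import Order.TTheory GRing.Theory Num.Theory.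
Import numFieldNormedType.Exports.
Import ComplexField.Normc.
Local Open Scope classical_set_scope.
Local Open Scope ring_scope.

(** * Determinants of rows of derivatives *)

Section RowReplacement.
Variables (R : comNzRingType) (n : nat).
Implicit Types (A G L : 'M[R]_n) (x : 'rV[R]_n).

Definition upd_row A i x : 'M[R]_n :=
  \matrix_(k, j) if k == i then x 0 j else A k j.

Lemma det_upd_row A i x :
  \det (upd_row A i x) = \sum_j x 0 j * cofactor A i j.
Proof.
rewrite (expand_det_row _ i); apply: eq_bigr => j _.
rewrite mxE eqxx; congr (_ * (_ * \det _)).
by apply/matrixP=> k l; rewrite !mxE eq_sym (negPf (neq_lift _ _)).
Qed.

(** Cramer's rule in adjugate form writes [\det A * x] as a combination of the rows of [A], and the
    determinant of [G] is linear in its row [i]. No division occurs. *)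
Lemma det_exchange A G i x :
  \det A * \det (upd_row G i x)
  = \sum_k \det (upd_row A k x) * \det (upd_row G i (row k A)).
Proof.
have cramer j : \det A * x 0 j = \sum_k \det (upd_row A k x) * A k j.
  under eq_bigr => k _ do rewrite det_upd_row mulr_suml.
  rewrite exchange_big /=.
  transitivity (\sum_l x 0 l * (\adj A *m A) l j).
    rewrite mul_adj_mx (bigD1 j) //= big1 ?addr0 => [|l /negPf nlj].
      by rewrite mxE eqxx mulrC.
    by rewrite mxE nlj mulr0n mulr0.
  apply: eq_bigr => l _; rewrite mxE mulr_sumr.
  by apply: eq_bigr => k _; rewrite mxE mulrA.
rewrite det_upd_row mulr_sumr.
under [RHS]eq_bigr => k _ do rewrite [X in _ * X]det_upd_row mulr_sumr.
rewrite exchange_big /=; apply: eq_bigr => j _.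
rewrite mulrA cramer mulr_suml; apply: eq_bigr => k _.
by rewrite mxE [RHS]mulrA.
Qed.

(** Cofactor expansion makes the sum [\tr (A *m L *m \adj A)]; cyclicity of the trace brings
    [\adj A] next to [A]. *)
Lemma sum_det_upd_row_mul A L :
  \sum_k \det (upd_row A k (row k (A *m L))) = \tr L * \det A.
Proof.
under eq_bigr => k _ do rewrite det_upd_row.
transitivity (\tr (A *m L *m \adj A)).
  apply: eq_bigr => k _; rewrite mxE; apply: eq_bigr => j _.
  by rewrite [in LHS]mxE; congr (_ * _); rewrite mxE.
by rewrite mxtrace_mulC mulmxA mul_adj_mx mul_scalar_mx mxtraceZ mulrC.
Qed.

End RowReplacement.

(** * Minors with prescribed rows *)

Section RowSelection.
Variables (R : comNzRingType) (T : Type) (n : nat).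
Variable V : T -> 'I_n -> R.
Implicit Types k : 'I_n -> T.

(** The index type [T] is left open: rows are numbered by derivative orders in [nat], and by
    [option nat] once a further row is adjoined. *)
Definition minor k : R := \det (\matrix_(i < n, j < n) V (k i) j).

Definition upd k i (m : T) : 'I_n -> T := fun l => if l == i then m else k l.

Lemma eq_minor k k' : k =1 k' -> minor k = minor k'.
Proof.
by move=> e; congr (\det _); apply/matrixP=> i j; rewrite !mxE e.
Qed.

Lemma minor_dup k i j : i != j -> k i = k j -> minor k = 0.
Proof.
by move=> ij e; apply: (determinant_alternate ij) => l; rewrite !mxE e.
Qed.

Lemma minor_swap k i j : i != j -> minor (k \o tperm i j) = - minor k.
Proof.
move=> ij; rewrite /minor; set A := \matrix_(_, _) V (k _) _.
transitivity (\det (row_perm (tperm i j) A)).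
  by congr (\det _); apply/matrixP=> a b; rewrite !mxE.
by rewrite row_permE det_mulmx det_perm odd_tperm ij expr1 mulN1r.
Qed.

Lemma minor_upd k i m :
  minor (upd k i m)
  = \det (upd_row (\matrix_(i < n, j < n) V (k i) j) i (\row_j V m j)).
Proof.
congr (\det _); apply/matrixP=> a b; rewrite !mxE /upd.
by case: (a == i).
Qed.

End RowSelection.

(** * Derivatives of a Wronskian as minors with nearly consecutive rows *)

Section ConsecutiveRows.
Variables (R : comNzRingType) (m : nat).
Variable V : nat -> 'I_m.+1 -> R.

Definition bump_row n (k : 'I_n -> nat) i : 'I_n -> nat := upd k i (k i).+1.

Local Notation id0 := (@nat_of_ord m.+1).

(* If V k is the k-th derivative of V 0, then minor0 is a Wronskian W,
   minor1 = W' and minor11 + minor2 = W''. *)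
Definition minor0 := minor V id0.
Definition minor1 := minor V (bump_row id0 ord_max).
Definition minor11 := minor V (upd id0 ord_max m.+2).
Definition minor2 :=
  \sum_(i | i != ord_max) minor V (bump_row (bump_row id0 ord_max) i).

(** Row [i] becomes a copy of row [i + 1]. The condition bears on these two rows only, so the lemma
    still applies after the last row has been raised. *)
Lemma bump_row_dup (k : 'I_m.+1 -> nat) (i : 'I_m.+1) :
    (i.+1 < m.+1)%N ->
    (forall j : 'I_m.+1, j = i.+1 :> nat -> k j = (k i).+1) ->
  minor V (bump_row k i) = 0.
Proof.
move=> lt_i ek; have ne : i != Ordinal lt_i.
  by apply/eqP => /(congr1 val) /=; lia.
apply: (minor_dup V ne).
by rewrite /bump_row /upd eqxx eq_sym (negPf ne) (ek (Ordinal lt_i)).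
Qed.

Lemma neq_ord_max (i : 'I_m.+1) : i != ord_max -> (i < m)%N.
Proof.
by rewrite -val_eqE /= => /eqP ni; have := ltn_ord i; lia.
Qed.

Lemma sum_bump_minor0 : \sum_i minor V (bump_row id0 i) = minor1.
Proof.
rewrite (bigD1 ord_max) //= big1 ?addr0 // => i /neq_ord_max lt_i.
by apply: bump_row_dup.
Qed.

Lemma sum_bump_minor1 :
  \sum_i minor V (bump_row (bump_row id0 ord_max) i) = minor11 + minor2.
Proof.
rewrite (bigD1 ord_max) //=; congr (_ + _); apply: eq_minor => i.
by rewrite /bump_row /upd; case: eqP; rewrite ?eqxx.
Qed.

(** For [i + 1 < m] both sides have a repeated row. For [i + 1 = m] the two minors differ by the
    exchange of their last two rows. *)
Lemma minor_skip (i : 'I_m.+1) : i != ord_max ->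
  minor V (upd id0 i i.+2) = - minor V (bump_row (bump_row id0 ord_max) i).
Proof.
move=> ni; have lt_im := neq_ord_max ni.
case: (ltngtP i.+1 m) => [lt_i|//|eq_i]; last 2 first.
- by move=> ?; lia.
- rewrite -(@minor_swap _ _ _ _ _ i ord_max ni); apply: eq_minor => l.
  rewrite /= /bump_row /upd; case: tpermP => [->|->|/eqP nl1 /eqP nl2].
  + by rewrite eqxx eq_sym (negPf ni) ?eqxx ?eq_i ?(negPf ni).
  + by rewrite eqxx eq_sym (negPf ni) ?eqxx ?eq_i ?(negPf ni).
  + by rewrite (negPf nl1) (negPf nl2).
rewrite [X in - X]bump_row_dup ?oppr0 //; last first.
  move=> j ej; rewrite /bump_row /upd (negPf ni).
  by case: eqP => // ejm; move: ej; rewrite ejm /=; lia.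
have lt2 : (i.+2 < m.+1)%N by [].
have ne : i != Ordinal lt2 by apply/eqP => /(congr1 val) /=; lia.
by apply: (minor_dup V ne); rewrite /upd eqxx eq_sym (negPf ne).
Qed.

(* The left-hand sides below are the rows of V multiplied by diag(lam), so this
   is the trace formula sum_k det(A; row k <- row k (A L)) = tr L det A. *)
Lemma minor_ode (c : R) (a b : nat -> R) (lam : 'I_m.+1 -> R) :
    (forall k j, c * V k.+2 j + a k * V k.+1 j + b k * V k j = lam j * V k j) ->
  c * (minor11 - minor2) + a m * minor1 + (\sum_(i < m.+1) b i) * minor0
  = (\sum_j lam j) * minor0.
Proof.
move=> ode.
set A := \matrix_(i < m.+1, j < m.+1) V i j.
pose L := diag_mx (\row_j lam j).
have -> : \sum_j lam j = \tr L by apply: eq_bigr => j _; rewrite !mxE eqxx.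
rewrite -[RHS](sum_det_upd_row_mul A L).
transitivity (\sum_(i < m.+1) (c * minor V (upd id0 i i.+2)
    + a i * minor V (bump_row id0 i) + b i * minor V (upd id0 i i))); last first.
  apply: eq_bigr => i _; rewrite /bump_row !minor_upd !det_upd_row.
  rewrite !mulr_sumr -!big_split /=; apply: eq_bigr => j _.
  move: (cofactor _ _ _) => C; rewrite !mxE !mulrA -!mulrDl ode; congr (_ * _).
  rewrite (bigD1 j) //= !mxE eqxx mulr1n big1 ?addr0 1?mulrC // => l nl.
  by rewrite !mxE (negPf nl) mulr0n mulr0.
have minor_idE i : minor V (upd id0 i i) = minor0.
  by apply: eq_minor => l; rewrite /upd; case: eqP => // ->.
rewrite !big_split /=; congr (_ + _ + _).
(* Raising a row other than the last by two costs a sign: these terms give [- minor2], although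
   [minor2] has a plus sign in the second derivative. *)
- rewrite (bigD1 ord_max) //= mulrBr; congr (_ + _).
  rewrite /minor2 mulr_sumr -sumrN; apply: eq_bigr => i ni.
  by rewrite minor_skip // mulrN.
- rewrite (bigD1 ord_max) //= big1 ?addr0 // => i /neq_ord_max lt_i.
  by rewrite bump_row_dup ?mulr0.
- by rewrite mulr_suml; apply: eq_bigr => i _; rewrite minor_idE.
Qed.

End ConsecutiveRows.

(** * The bilinear relation between Wronskians of [m + 1] and [m + 2] functions *)

Section CrumIdentity.
Variables (R : comNzRingType) (m : nat).
Variable V : nat -> 'I_m.+2 -> R.

Definition drop_col : nat -> 'I_m.+1 -> R :=
  fun k j => V k (widen_ord (leqnSn m.+1) j).

(* The extra row None, a unit vector, turns W into a determinant of the size of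
   U. *)
Let ext (t : option nat) (j : 'I_m.+2) : R :=
  if t is Some k then V k j else (j == ord_max)%:R.

(** Expansion along the last row, which is the unit vector of the last column; its diagonal position
    makes the sign [+1]. *)
Lemma minor_ext (k : 'I_m.+2 -> option nat) (k' : 'I_m.+1 -> nat) :
    k ord_max = None ->
    (forall i, k (widen_ord (leqnSn m.+1) i) = Some (k' i)) ->
  minor ext k = minor drop_col k'.
Proof.
move=> kmax kwid; have liftE (i : 'I_m.+1) :
    lift ord_max i = widen_ord (leqnSn m.+1) i.
  by apply: val_inj; rewrite /= /bump leqNgt ltn_ord.
rewrite /minor (expand_det_row _ ord_max) (bigD1 ord_max) //= big1 => [|j nj].
  rewrite mxE kmax /= eqxx mul1r addr0 /cofactor -signr_odd addnn odd_double.
  rewrite expr0 mul1r; congr (\det _); apply/matrixP => i j.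
  by rewrite !mxE !liftE kwid.
by rewrite mxE kmax /= (negPf nj) mul0r.
Qed.

Local Notation W := (minor0 drop_col).
Local Notation W1 := (minor1 drop_col).
Local Notation W11 := (minor11 drop_col).
Local Notation W2 := (minor2 drop_col).
Local Notation U := (minor0 V).
Local Notation U1 := (minor1 V).
Local Notation U11 := (minor11 V).
Local Notation U2 := (minor2 V).

(** The penultimate row, of index [m]. *)
Let pen : 'I_m.+2 := widen_ord (leqnSn m.+1) ord_max.

Let pen_max : pen != ord_max.
Proof. by apply/eqP => /(congr1 val) /=; lia. Qed.

(** Raising a row before [pen] duplicates the next one, so a single term of [minor2] survives. *)
Lemma minor2_pen :
  U2 = minor V (fun i : 'I_m.+2 => if (i < m)%N then i : nat else i.+1).
Proof.
rewrite /minor2 (bigD1 pen) //= big1 ?addr0 => [|i /andP[/neq_ord_max]].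
  apply: eq_minor => i; rewrite /bump_row /upd -!val_eqE /=.
  by have := ltn_ord i; do !case: ifP; lia.
move=> lt_i; rewrite -val_eqE /= => /eqP ni.
apply: bump_row_dup => [|j ej]; first by lia.
by rewrite /bump_row /upd -!val_eqE /= ej; do 2![case: eqP => // ?]; lia.
Qed.

(* Row m + 1 is exchanged between (v_0, .., v_m, e) and
   (v_0, .., v_(m-1), *, v_(m+2)), where e is the extra row. *)
Lemma minor_pluecker : W * U2 = W1 * U1 - U * W11.
Proof.
pose kA (i : 'I_m.+2) := if i == ord_max then None else Some (i : nat).
pose kG (i : 'I_m.+2) := if i == ord_max then Some m.+2 else Some (i : nat).
have widE (i : 'I_m.+1) : (widen_ord (leqnSn m.+1) i == ord_max) = false.
  by apply/eqP => /(congr1 val) /=; have := ltn_ord i; lia.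
have exch := det_exchange (\matrix_(i, j) ext (kA i) j)
  (\matrix_(i, j) ext (kG i) j) pen (\row_j V m.+1 j).
have rowE k : row k (\matrix_(i, j) ext (kA i) j) = \row_j ext (kA k) j.
  by apply/rowP => j; rewrite !mxE.
have updE (k : 'I_m.+2 -> option nat) i t :
    \det (upd_row (\matrix_(i, j) ext (k i) j) i (\row_j ext t j))
    = minor ext (upd k i t) by rewrite minor_upd.
have WE : \det (\matrix_(i, j) ext (kA i) j) = W.
  by apply: minor_ext => [|i]; rewrite /kA ?eqxx ?widE.
have SomeE (k : 'I_m.+2 -> option nat) k' : (forall i, k i = Some (k' i)) ->
    minor ext k = minor V k'.
  by move=> e; congr (\det _); apply/matrixP=> i j; rewrite !mxE e.
rewrite WE in exch.
have -> : U2
    = \det (upd_row (\matrix_(i, j) ext (kG i) j) pen (\row_j V m.+1 j)).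
  rewrite minor2_pen (updE kG pen (Some m.+1)).
  rewrite -(@SomeE (upd kG pen (Some m.+1))) //.
  move=> i; rewrite /upd /kG -!val_eqE /=; have := ltn_ord i.
  by do !case: ifP; move=> *; congr Some; lia.
(* Every row of the first matrix other than [pen] and [ord_max] also occurs in the second, where
   inserting it gives a repeated row. *)
rewrite exch (bigD1 ord_max) //= (bigD1 pen) ?pen_max //= big1 ?addr0;
    last first.
  move=> k /andP[nk1 nk2]; rewrite rowE updE.
  rewrite [X in _ * X](@minor_dup _ _ _ _ _ k pen) ?mulr0 //.
  by rewrite /upd eqxx (negPf nk2) /kG /kA (negPf nk1).
rewrite !rowE !updE (updE kA pen (Some m.+1)) (updE kA ord_max (Some m.+1)).
rewrite addrC; congr (_ * _ + _).
- apply: minor_ext => [|i]; rewrite /upd /kA ?widE.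
    by rewrite eq_sym (negPf pen_max) eqxx.
  by rewrite /bump_row /upd -!val_eqE /=; case: eqP.
- apply: SomeE => i; rewrite /upd /kG /kA /bump_row /upd (negPf pen_max).
  case: eqP => [->|_]; first by rewrite (negPf pen_max).
  by case: eqP.
rewrite -mulrN; congr (_ * _).
  apply: SomeE => i; rewrite /upd /kA.
  by case: eqP => [->|].
(* The unit row now stands in position [pen]; moving it to the end by a transposition produces the
   minus sign. *)
rewrite /minor11.
rewrite -(@minor_ext (upd kA pen (Some m.+2)) (upd (@nat_of_ord _) ord_max m.+2)).
- rewrite -(@minor_swap _ _ _ _ _ pen ord_max) //; apply: eq_minor => i.
  rewrite /= /upd /kG /kA; case: tpermP => [->|->|/eqP n1 /eqP n2].
  + by rewrite !eqxx (eq_sym ord_max) (negPf pen_max).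
  + by rewrite !eqxx (eq_sym ord_max) (negPf pen_max).
  + by rewrite (negPf n1) (negPf n2).
- by rewrite /upd eq_sym (negPf pen_max) /kA eqxx.
- by move=> i; rewrite /upd /kA widE -!val_eqE /=; case: ifP.
Qed.

(** Take [W] times [minor_ode] for [U] minus [U] times [minor_ode] for [W]: all eigenvalues but the
    last cancel. Adding [2 c] times the Pluecker relation turns the differences [U11 - U2] and
    [W11 - W2] into the second derivatives [U11 + U2] and [W11 + W2]. *)
Lemma crum_minors (c : R) (a b : nat -> R) (lam : 'I_m.+2 -> R) :
    (forall k j, c * V k.+2 j + a k * V k.+1 j + b k * V k j = lam j * V k j) ->
  c * ((U11 + U2) * W - (U1 * W1) *+ 2 + U * (W11 + W2))
  + a m.+1 * (U1 * W) - a m * (U * W1) + (b m.+1 - lam ord_max) * (U * W) = 0.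
Proof.
move=> ode; have odeU := minor_ode ode.
have odeW := @minor_ode _ _ drop_col c a b
  (fun j => lam (widen_ord (leqnSn m.+1) j)) (fun k j => ode k _).
rewrite !(big_ord_recr m.+1) /= in odeU.
move: odeU odeW minor_pluecker; set S := \sum_(i < m.+1) b i.
set L := \sum_(i < m.+1) lam _ => odeU odeW plu.
transitivity (W * (c * (U11 - U2) + a m.+1 * U1 + (S + b m.+1) * U
                   - (L + lam ord_max) * U)
  - U * (c * (W11 - W2) + a m * W1 + S * W - L * W)
  + (c *+ 2) * (W * U2 - (W1 * U1 - U * W11))); first by ring.
by rewrite odeU odeW plu !subrr !mulr0 subrr addr0.
Qed.

End CrumIdentity.

(** * Wronskians and Crum's identity *)

Section Derivatives.
Variable R : realType.
Implicit Types (f g : R -> R) (y : R) (D : set R).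

Lemma is_derive_add f g y a b : is_derive y 1 f a -> is_derive y 1 g b ->
  is_derive y 1 (fun z => f z + g z) (a + b).
Proof. by move=> df dg; exact: is_deriveD. Qed.

Lemma is_derive_mul f g y a b : is_derive y 1 f a -> is_derive y 1 g b ->
  is_derive y 1 (fun z => f z * g z) (a * g y + f y * b).
Proof.
move=> df dg; apply: (is_derive_eq (is_deriveM df dg)).
by rewrite addrC; congr (_ + _); rewrite [LHS]mulrC.
Qed.

Lemma is_derive_mull (c : R) f y a : is_derive y 1 f a ->
  is_derive y 1 (fun z => c * f z) (c * a).
Proof.
move=> df; apply: (is_derive_eq (is_derive_mul (is_derive_cst c y 1) df)).
by rewrite mul0r add0r.
Qed.

Lemma is_derive_bigsum (I : Type) (r : seq I) (P : pred I) (F : I -> R -> R)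
    (dF : I -> R) y :
    (forall i, is_derive y 1 (F i) (dF i)) ->
  is_derive y 1 (fun z => \sum_(i <- r | P i) F i z) (\sum_(i <- r | P i) dF i).
Proof.
move=> dFi; elim: r => [|i r IHr].
  rewrite big_nil; under eq_fun do rewrite big_nil.
  exact: (is_derive_cst (0 : R)).
rewrite big_cons; under eq_fun do rewrite big_cons.
by case: (P i) => //; apply: is_derive_add.
Qed.

Lemma is_derive_prod n (F : 'I_n -> R -> R) (dF : 'I_n -> R) y :
    (forall i, is_derive y 1 (F i) (dF i)) ->
  is_derive y 1 (fun z => \prod_(i < n) F i z)
    (\sum_(i < n) \prod_(k < n) (if k == i then dF k else F k y)).
Proof.
elim: n F dF => [|n IHn] F dF dFi.
  rewrite big_ord0; under eq_fun do rewrite big_ord0.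
  exact: (is_derive_cst (1 : R)).
under eq_fun do rewrite big_ord_recr.
have dw := IHn _ _ (fun i => dFi (widen_ord (leqnSn n) i)).
apply: (is_derive_eq (is_derive_mul dw (dFi ord_max))).
rewrite [RHS]big_ord_recr /=; congr (_ + _).
  rewrite mulr_suml; apply: eq_bigr => i _.
  rewrite big_ord_recr /= -[_ == widen_ord _ i]val_eqE /= gtn_eqF //.
rewrite big_ord_recr /= eqxx; congr (_ * _); apply: eq_bigr => k _.
by rewrite -[_ == ord_max]val_eqE /= ltn_eqF.
Qed.

(** The product rule is applied to each term of the permutation expansion; exchanging the sums
    collects the terms in which row [i] is differentiated. *)
Lemma is_derive_minor n (V : nat -> 'I_n -> R -> R) (k : 'I_n -> nat) y :
    (forall l j, is_derive y 1 (V l j) (V l.+1 j y)) ->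
  is_derive y 1 (fun z => minor (fun l j => V l j z) k)
    (\sum_i minor (fun l j => V l j y) (bump_row k i)).
Proof.
move=> dV; rewrite /minor /determinant.
apply: is_derive_eq.
  apply: is_derive_bigsum => s; apply: is_derive_mull.
  apply: (is_derive_prod (dF := fun i => V (k i).+1 (s i) y)) => i.
  by under eq_fun do rewrite mxE; exact: dV.
rewrite exchange_big /=; apply: eq_bigr => s _.
rewrite mulr_sumr; apply: eq_bigr => i _; congr (_ * _); apply: eq_bigr => l _.
by rewrite !mxE /bump_row /upd; case: eqP => // ->.
Qed.

Definition smooth_on D f := forall l y, D y -> derivable (derive1n l f) y 1.

Lemma is_derive_derive1n D f l y : smooth_on D f -> D y ->
  is_derive y 1 (derive1n l f) (derive1n l.+1 f y).
Proof.
move=> sf Dy; apply: DeriveDef; first exact: sf.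
by rewrite derive1nS derive1E.
Qed.

Lemma is_derive_on D f g y a : open D -> D y -> (forall z, D z -> f z = g z) ->
  is_derive y 1 f a -> is_derive y 1 g a.
Proof.
move=> oD Dy fg; apply: near_eq_is_derive.
by near=> z; apply: fg; near: z; exact: open_nbhs_nbhs.
Unshelve. all: by end_near. Qed.

Lemma is_derive_on_unique D f g y a b : open D -> D y ->
    (forall z, D z -> f z = g z) ->
  is_derive y 1 f a -> is_derive y 1 g b -> a = b.
Proof.
move=> oD Dy fg df dg.
have dfg := is_derive_on oD Dy fg df.
by rewrite -(@derive_val _ _ _ _ _ _ _ dfg) (@derive_val _ _ _ _ _ _ _ dg).
Qed.

(** By induction on the order, each iterated derivative agrees on [D] with a member of the class, so
    no formula for higher derivatives is required. *)
Lemma smooth_on_class D (P : (R -> R) -> Prop) f : open D ->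
    (forall g, P g ->
      exists2 g', P g' & forall y, D y -> is_derive y 1 g (g' y)) ->
  P f -> smooth_on D f.
Proof.
move=> oD HP Pf l.
suff [g Pg fg] : exists2 g, P g & forall y, D y -> g y = derive1n l f y.
  move=> y Dy; have [g' _ /(_ y Dy) dg] := HP _ Pg.
  by have [] := is_derive_on oD Dy fg dg.
elim: l => [|l [g Pg fg]]; first by exists f.
have [g' Pg' dg] := HP _ Pg; exists g' => // y Dy.
have df := is_derive_on oD Dy fg (dg _ Dy).
by rewrite derive1nS derive1E (@derive_val _ _ _ _ _ _ _ df).
Qed.

Lemma poly_eq0_on01 (p : {poly R}) :
  (forall y, 0 < y < 1 -> p.[y] = 0) -> p = 0.
Proof.
move=> p0; apply/eqP/contraT => pn0.
(* The shift by 2 keeps these points strictly between 0 and 1; there are [size p] of them, too many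
   for a nonzero [p]. *)
pose rs := [seq (k.+2%:R : R)^-1 | k <- iota 0 (size p)].
have := @max_poly_roots _ p rs pn0; rewrite size_map size_iota ltnn => -> //.
  apply/allP => _ /mapP[k _ ->]; rewrite rootE p0 //.
  by rewrite invr_gt0 ltr0n invf_lt1 ?ltr0n // ltr1n.
rewrite map_inj_uniq ?iota_uniq // => i j /invr_inj /eqP.
by rewrite eqr_nat => /eqP[].
Qed.

End Derivatives.

(** * Crum's identity for polynomials attached to Wronskians *)

Section Crum.
Variables (R : realType) (D : set R).
Hypotheses (oD : open D) (D01 : forall y, 0 < y < 1 -> D y).
Variables (c d : {poly R}).
Hypotheses (c3 : c^`(3) = 0) (d2 : d^`(2) = 0).
Hypothesis c_neq0 : forall y, D y -> c.[y] != 0.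
Implicit Types (f : R -> R) (p tau : {poly R}).

Definition solves (lam : R) f := forall y, D y ->
  c.[y] * derive1n 2 f y + d.[y] * derive1n 1 f y = lam * f y.

(** With [ode_b], the Leibniz coefficients of the equation differentiated [k] times. Orders below
    [k] do not appear, since [c] has degree at most 2 and [d] at most 1. *)
Definition ode_d k : {poly R} := d + c^`() *+ k.
Definition ode_b k : {poly R} := \sum_(i < k) (ode_d i)^`().

Lemma solves_derive1n lam f k y : smooth_on D f -> solves lam f -> D y ->
  c.[y] * derive1n k.+2 f y + (ode_d k).[y] * derive1n k.+1 f y
    + (ode_b k).[y] * derive1n k f y = lam * derive1n k f y.
Proof.
move=> sf ode; elim: k y => [|k IHk] y Dy.
  by rewrite /ode_d /ode_b big_ord0 mulr0n addr0 horner0 mul0r addr0 ode.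
have e1 := is_derive_on_unique oD Dy IHk.
have dn l := is_derive_derive1n l sf Dy.
have := e1 _ _ (is_derive_add (is_derive_add
   (is_derive_mul (is_derive_poly c y) (dn k.+2))
   (is_derive_mul (is_derive_poly (ode_d k) y) (dn k.+1)))
   (is_derive_mul (is_derive_poly (ode_b k) y) (dn k))) (is_derive_mull lam (dn k)).
(* The degree bounds [c3] and [d2] enter here: [ode_b k] is a constant. *)
have -> : (ode_b k)^`() = 0.
  rewrite /ode_b raddf_sum big1 // => i _; rewrite /ode_d derivD derivMn.
  by rewrite /= derivD derivMn [c^`()^`()^`()]c3 [d^`()^`()]d2 mul0rn addr0.
have odS : ode_d k.+1 = ode_d k + c^`() by rewrite /ode_d mulrSr addrA.
have obS : ode_b k.+1 = ode_b k + (ode_d k)^`() by rewrite /ode_b big_ord_recr.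
rewrite obS odS horner0 mul0r add0r !hornerD => <-.
move: (derive1n k.+3 f y) (derive1n k.+2 f y) (derive1n k.+1 f y) => f3 f2 f1.
by ring.
Qed.

(** Prefactors are handled only through their logarithmic derivative [tau / c], which replaces real
    powers by polynomial arithmetic. *)
Definition weight tau (rho : R -> R) :=
  forall y, D y -> is_derive y 1 rho (rho y * tau.[y] / c.[y]).

(* [deriv_num tau p] is the polynomial attached to [f'] when [p] is attached to
   [f], i.e. when [p = f * rho] for a weight with [rho' / rho = tau / c]. *)
Definition deriv_num tau p : {poly R} := c * p^`() - tau * p.

(** Differentiate [p = f rho] and multiply by [c]. The new weight [c rho] has the numerator
    [tau + c'], so the step can be iterated. *)
Lemma deriv_num_weight tau p f f1 (rho : R -> R) :
    weight tau rho ->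
    (forall y, D y -> is_derive y 1 f (f1 y)) ->
    (forall y, D y -> p.[y] = f y * rho y) ->
  forall y, D y -> (deriv_num tau p).[y] = f1 y * (c.[y] * rho y).
Proof.
move=> drho df pE y Dy.
have dp := is_derive_on_unique oD Dy pE (is_derive_poly p y)
  (is_derive_mul (df _ Dy) (drho _ Dy)).
rewrite /deriv_num hornerD hornerN !hornerM dp pE //; field; exact: c_neq0.
Qed.

Lemma weight_c tau rho : weight tau rho ->
  weight (tau + c^`()) (fun y => c.[y] * rho y).
Proof.
move=> drho y Dy.
apply: (is_derive_eq (is_derive_mul (is_derive_poly c y) (drho _ Dy))).
by rewrite hornerD; field; exact: c_neq0.
Qed.

Lemma wronskianE (fs : seq (R -> R)) n y : size fs = n ->
  wronskian fs y = minor (fun k (j : 'I_n) => derive1n k (nth (fun=> 0) fs j) y)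
    (fun i : 'I_n => i : nat).
Proof. by move=> <-. Qed.

Section Wronskian.
Variables (fs : seq (R -> R)) (m : nat).
Hypotheses (size_fs : size fs = m.+1).
Hypothesis smooth_fs : forall j, (j < m.+1)%N -> smooth_on D (nth (fun=> 0) fs j).

Local Notation V y := (fun k (j : 'I_m.+1) => derive1n k (nth (fun=> 0) fs j) y).

Lemma is_derive_wronskian y : D y ->
  is_derive y 1 (wronskian fs) (minor1 (V y)).
Proof.
move=> Dy; rewrite -sum_bump_minor0.
have -> : wronskian fs = fun z => minor0 (V z).
  by apply/funext => z; rewrite (wronskianE z size_fs).
apply: is_derive_minor => l j; apply: is_derive_derive1n Dy.
exact: smooth_fs.
Qed.

Lemma is_derive_wronskian1 y : D y ->
  is_derive y 1 (fun z => minor1 (V z)) (minor11 (V y) + minor2 (V y)).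
Proof.
move=> Dy; rewrite -sum_bump_minor1.
apply: is_derive_minor => l j; apply: is_derive_derive1n Dy.
exact: smooth_fs.
Qed.

Lemma wronskian_weight tau (rho : R -> R) p :
    weight tau rho ->
    (forall y, D y -> p.[y] = wronskian fs y * rho y) ->
  forall y, D y ->
  [/\ p.[y] = minor0 (V y) * rho y,
      (deriv_num tau p).[y] = minor1 (V y) * (c.[y] * rho y)
    & (deriv_num (tau + c^`()) (deriv_num tau p)).[y]
      = (minor11 (V y) + minor2 (V y)) * (c.[y] * (c.[y] * rho y))].
Proof.
move=> drho pE; have pE1 := deriv_num_weight drho is_derive_wronskian pE.
have pE2 := deriv_num_weight (weight_c drho)
  is_derive_wronskian1 pE1.
by move=> y Dy; split; [rewrite pE // (wronskianE y size_fs)|exact: pE1|exact: pE2].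
Qed.

End Wronskian.

(** Multiplication by [c^2 rhoU rhoW] turns the terms of [crum_minors] into values of polynomials.
    Valid on the interval from 0 to 1, the relation then holds between polynomials and may be
    evaluated at complex points. *)
Lemma crum_poly (fs : seq (R -> R)) phi m lam lphi tauU tauW
    (rhoU rhoW : R -> R) (P X : {poly R}) :
    size fs = m.+1 ->
    (forall j, (j < m.+1)%N -> smooth_on D (nth (fun=> 0) fs j)) ->
    smooth_on D phi ->
    (forall j, (j < m.+1)%N -> solves (lam j) (nth (fun=> 0) fs j)) ->
    solves lphi phi ->
    weight tauU rhoU ->
    weight tauW rhoW ->
    (forall y, D y -> P.[y] = wronskian (rcons fs phi) y * rhoU y) ->
    (forall y, D y -> X.[y] = wronskian fs y * rhoW y) ->
  let P1 := deriv_num tauU P in let P2 := deriv_num (tauU + c^`()) P1 in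
  let X1 := deriv_num tauW X in let X2 := deriv_num (tauW + c^`()) X1 in
  c * (P2 * X - (P1 * X1) *+ 2 + P * X2) + ode_d m.+1 * c * P1 * X
  - ode_d m * c * P * X1 + (ode_b m.+1 - lphi%:P) * c ^+ 2 * P * X = 0.
Proof.
move=> size_fs sfs sphi ofs ophi dU dW PE XE P1 P2 X1 X2.
pose gs := rcons fs phi; pose lam' j := if (j < m.+1)%N then lam j else lphi.
have size_gs : size gs = m.+2 by rewrite size_rcons size_fs.
have nth_gs j : (j < m.+2)%N -> nth (fun=> 0) gs j
    = if (j < m.+1)%N then nth (fun=> 0) fs j else phi.
  move=> lt_j; rewrite nth_rcons size_fs; case: ltnP => // le_j.
  by rewrite ifT //; lia.
have sgs j : (j < m.+2)%N -> smooth_on D (nth (fun=> 0) gs j).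
  move=> lt_j; rewrite (nth_gs _ lt_j); case: ifP => lt'; [exact: sfs|exact: sphi].
have ogs j : (j < m.+2)%N -> solves (lam' j) (nth (fun=> 0) gs j).
  move=> lt_j; rewrite (nth_gs _ lt_j) /lam'.
  by case: ifP => lt'; [exact: ofs|exact: ophi].
apply: poly_eq0_on01 => y /D01 Dy.
have [p0 p1 p2] := wronskian_weight size_gs sgs dU PE Dy.
have [x0 x1 x2] := wronskian_weight size_fs sfs dW XE Dy.
rewrite -/P1 -/P2 -/X1 -/X2 in p1 p2 x1 x2.
clearbody P1 P2 X1 X2.
rewrite !(hornerD, hornerN, hornerM, hornerMn, hornerC, hornerXn, horner_exp).
rewrite p0 p1 p2 x0 x1 x2.
have := @crum_minors _ m (fun k j => derive1n k (nth (fun=> 0) gs j) y) c.[y]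
  (fun k => (ode_d k).[y]) (fun k => (ode_b k).[y]) (fun j => lam' j).
have -> : drop_col (fun k (j : 'I_m.+2) => derive1n k (nth (fun=> 0) gs j) y)
    = (fun k (j : 'I_m.+1) => derive1n k (nth (fun=> 0) fs j) y).
  apply/funext => k; apply/funext => j.
  by rewrite /drop_col nth_gs ?ltn_ord //= ltn_ord.
move=> /(_ (fun k j =>
  solves_derive1n k (sgs j (ltn_ord j)) (ogs j (ltn_ord j)) Dy)).
rewrite /lam' /= ltnn.
move=> /(congr1 ( *%R (c.[y] ^+ 2 * rhoU y * rhoW y))); rewrite mulr0.
by apply: etrans; rewrite /ode_d !(hornerD, hornerMn); ring.
Qed.

End Crum.

(** * The seed functions *)

Section ClassicalODE.
Variable R : realType.
Implicit Types (a b y : R) (p : {poly R}).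

(** Comparison of coefficients; the second hypothesis says that the recurrence stops at degree [n].
    Laguerre is [e = 0], and Jacobi is [e = 1] in the variable [(y - 1) / 2]. *)
Lemma hypergeometric_ode (n : nat) (u : nat -> R) (e al be ga : R) :
    (forall k, (k < n)%N -> (k.+1)%:R * (k%:R + al) * u k.+1
       + (e * k%:R * (k%:R - 1) + be * k%:R + ga) * u k = 0) ->
    e * n%:R * (n%:R - 1) + be * n%:R + ga = 0 ->
  let p := \sum_(k < n.+1) u k *: 'X^k in
  (e *: 'X^2 + 'X) * p^`(2) + (al%:P + be *: 'X) * p^`() + ga *: p = 0.
Proof.
move=> rec last p.
have pE k : p`_k = if (k < n.+1)%N then u k else 0.
  by rewrite /p -poly_def coef_poly.
apply/polyP => i; rewrite coef0.
rewrite derivnS derivn1 !mulrDl !coefD -!scalerAl !coefZ coefCM expr2 -!mulrA.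
rewrite !coefXM.
have E : i.+1%:R * (i%:R + al) * p`_i.+1
    + (e * i%:R * (i%:R - 1) + be * i%:R + ga) * p`_i = 0.
  rewrite !pE; case: (ltngtP i n) => [lt_i|gt_i|->].
  - by rewrite !ltnS lt_i ltnW // rec.
  - rewrite !ifF ?mulr0 ?addr0 //; lia.
  - by rewrite ltnn ltnSn last mulr0 mul0r addr0.
have derivE (q : {poly R}) k : q^`()`_k = k.+1%:R * q`_k.+1.
  by rewrite coef_deriv mulr_natl.
case: i E => [|[|i]] E; rewrite -[RHS]E ?coefXM /= !derivE ?natr1; ring.
Qed.

Lemma pochhammerSl a n : pochhammer a n.+1 = a * pochhammer (a + 1) n.
Proof.
rewrite /pochhammer big_ord_recl addr0; congr (_ * _).
by apply: eq_bigr => i _; rewrite /= /bump /= natrD addrA.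
Qed.

Lemma pochhammerSr a n : pochhammer a n.+1 = pochhammer a n * (a + n%:R).
Proof. by rewrite /pochhammer big_ord_recr. Qed.

Lemma laguerre_ode n a y : let p := laguerre n a in
  y * p^`(2).[y] + (a + 1 - y) * p^`().[y] = - n%:R * p.[y].
Proof.
pose u k : R :=
  (-1) ^+ k * pochhammer (a + k%:R + 1) (n - k) / (k`! * (n - k)`!)%:R.
have rec k : (k < n)%N -> (k.+1)%:R * (k%:R + (a + 1)) * u k.+1
    + (0 * k%:R * (k%:R - 1) + (-1) * k%:R + n%:R) * u k = 0.
  move=> lt_k; rewrite /u.
  have [m nkE] : exists m, (n - k = m.+1)%N by exists (n - k.+1)%N; lia.
  have -> : (n - k.+1 = m)%N by lia.
  have -> : (n%:R : R) = k%:R + m.+1%:R by rewrite -natrD; congr _%:R; lia.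
  rewrite nkE pochhammerSl !factS !natrM exprS.
  have -> : a + k.+1%:R + 1 = a + k%:R + 1 + 1 by rewrite -natr1; ring.
  have f0 l : (l`!)%:R != 0 :> R by rewrite pnatr_eq0 -lt0n fact_gt0.
  have s0 l : l%:R + 1 != 0 :> R by rewrite natr1 pnatr_eq0.
  move: (pochhammer _ _) => ph; rewrite -!natr1.
  by field; rewrite !f0 !s0.
have last : 0 * n%:R * (n%:R - 1) + (-1) * n%:R + n%:R = 0 :> R by ring.
have /(congr1 (horner^~ y)) := hypergeometric_ode rec last.
rewrite -/(laguerre n a) !(hornerD, hornerM, hornerZ, hornerX, hornerC) => E.
apply/eqP; rewrite mulNr -addr_eq0; apply/eqP; rewrite -[RHS]E; ring.
Qed.

Lemma jacobi_ode n a b y : let p := jacobi n a b in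
  (1 - y ^+ 2) * p^`(2).[y] + (b - a - (a + b + 2) * y) * p^`().[y]
  = - n%:R * (n%:R + a + b + 1) * p.[y].
Proof.
pose u k : R :=
  pochhammer (n%:R + a + b + 1) k * pochhammer (a + k%:R + 1) (n - k) / (k`! * (n - k)`!)%:R.
pose q : {poly R} := \sum_(k < n.+1) u k *: 'X^k.
pose w : {poly R} := 2^-1 *: ('X - 1).
have jE : jacobi n a b = q \Po w.
  rewrite /q raddf_sum; apply: eq_bigr => k _.
  by rewrite /= comp_polyZ comp_Xn_poly.
have w1 : w^`() = (2^-1)%:P.
  by rewrite /w derivZ derivB derivX derivC subr0 alg_polyC.
have rec k : (k < n)%N -> (k.+1)%:R * (k%:R + (a + 1)) * u k.+1
    + (1 * k%:R * (k%:R - 1) + (a + b + 2) * k%:R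
       + - n%:R * (n%:R + a + b + 1)) * u k = 0.
  move=> lt_k; rewrite /u.
  have [m nkE] : exists m, (n - k = m.+1)%N by exists (n - k.+1)%N; lia.
  have -> : (n - k.+1 = m)%N by lia.
  rewrite nkE pochhammerSr (pochhammerSl _ m) !factS !natrM.
  have -> : a + k.+1%:R + 1 = a + k%:R + 1 + 1 by rewrite -natr1; ring.
  have -> : (n%:R : R) = k%:R + m.+1%:R by rewrite -natrD; congr _%:R; lia.
  have f0 l : (l`!)%:R != 0 :> R by rewrite pnatr_eq0 -lt0n fact_gt0.
  have s0 l : l%:R + 1 != 0 :> R by rewrite natr1 pnatr_eq0.
  move: (pochhammer _ _) (pochhammer _ _) => ph ph'; rewrite -!natr1.
  by field; rewrite !f0 !s0.
have last : 1 * n%:R * (n%:R - 1) + (a + b + 2) * n%:R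
    + - n%:R * (n%:R + a + b + 1) = 0 :> R by ring.
have /(congr1 (horner^~ ((y - 1) / 2))) := hypergeometric_ode rec last.
rewrite -/q derivnS derivn1.
rewrite !(hornerD, hornerM, hornerZ, hornerX, hornerC, hornerXn).
move=> E /=.
rewrite jE ?derivnS ?derivn1 deriv_comp derivM deriv_comp w1 derivC mulr0 addr0.
rewrite !(hornerM, hornerC, horner_comp).
have wy : w.[y] = (y - 1) / 2.
  by rewrite /w hornerZ hornerD hornerX hornerN hornerC mulrC.
apply/eqP; rewrite mulNr mulNr -addr_eq0; apply/eqP.
(* For [t = (y - 1) / 2] one has [t^2 + t = - (1 - y^2) / 4], and the chain rule absorbs the 4; the
   two equations differ by a sign. *)
rewrite -[RHS](mulr0 (-1)) -E wy; by field.
Qed.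

End ClassicalODE.

(** * Products of a weight and a polynomial *)

Section Weighted.
Variables (R : realType) (D : set R) (oD : open D).
Variables (c d : {poly R}).
Hypotheses (c_neq0 : forall y, D y -> c.[y] != 0).
Implicit Types (p tau : {poly R}) (w f : R -> R).

Local Notation weight := (weight D c).

Lemma weight_mul tau tau' w w' : weight tau w -> weight tau' w' ->
  weight (tau + tau') (fun y => w y * w' y).
Proof.
move=> dw dw' y Dy; apply: (is_derive_eq (is_derive_mul (dw y Dy) (dw' y Dy))).
rewrite hornerD; field; exact: c_neq0.
Qed.

Lemma weight_div tau w : weight tau w ->
  weight (tau - c^`()) (fun y => w y / c.[y]).
Proof.
move=> dw y Dy; have cy := c_neq0 Dy.
have dc : is_derive y 1 (fun z => c.[z]^-1) (- c.[y] ^- 2 * c^`().[y]).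
  have dcy := is_derive_poly c y; apply: DeriveDef.
    by apply: derivableV => //; exact: derivable_horner.
  rewrite deriveV ?(@derive_val _ _ _ _ _ _ _ dcy) //; exact: derivable_horner.
apply: (is_derive_eq (is_derive_mul (dw y Dy) dc)).
rewrite hornerD hornerN; field; exact: cy.
Qed.

(** Numerator of the derivative of [w * p] over the weight [w / c]. As [w / c] is again a weight,
    such products are closed under differentiation. *)
Definition diff_weighted tau p : {poly R} := c * p^`() + tau * p.

Lemma is_derive_weighted tau w p y : weight tau w -> D y ->
  is_derive y 1 (fun z => w z * p.[z])
    (w y / c.[y] * (diff_weighted tau p).[y]).
Proof.
move=> dw Dy; apply: (is_derive_eq (is_derive_mul (dw y Dy) (is_derive_poly p y))).
rewrite /diff_weighted hornerD !hornerM; field; exact: c_neq0.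
Qed.

Lemma smooth_weighted tau w p f : weight tau w ->
  (forall y, D y -> f y = w y * p.[y]) -> smooth_on D f.
Proof.
move=> dw fE.
apply: (@smooth_on_class _ _ (fun g => exists tau w q,
  weight tau w /\ forall y, D y -> g y = w y * q.[y])) => //;
  last by exists tau, w, p.
move=> g [tau' [w' [q [dw' gE]]]].
exists (fun y => w' y / c.[y] * (diff_weighted tau' q).[y]).
  exists (tau' - c^`()), (fun y => w' y / c.[y]), (diff_weighted tau' q).
  by split=> //; exact: weight_div.
move=> y Dy; apply: (is_derive_on oD Dy _ (is_derive_weighted q dw' Dy)) => z Dz.
by rewrite gE.
Qed.

(** The condition on [p] is the equation for [w * p] multiplied by [c / w]. *)
Lemma solves_weighted tau w p f lam : weight tau w ->
    (forall y, D y -> f y = w y * p.[y]) ->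
    (forall y, D y -> c.[y] ^+ 2 * p^`(2).[y]
      + c.[y] * (2 * tau.[y] + d.[y]) * p^`().[y]
      + (c.[y] * tau^`().[y] + (tau.[y] - c^`().[y] + d.[y]) * tau.[y]) * p.[y]
      = lam * c.[y] * p.[y]) ->
  solves D c d lam f.
Proof.
move=> dw fE ode y Dy.
have f1E z : D z -> derive1n 1 f z = w z / c.[z] * (diff_weighted tau p).[z].
  move=> Dz; rewrite derive1n1 derive1E.
  have dfz := is_derive_on oD Dz (fun t Dt => esym (fE t Dt))
    (is_derive_weighted p dw Dz).
  exact: (@derive_val _ _ _ _ _ _ _ dfz).
have f2E : derive1n 2 f y = w y / c.[y] / c.[y]
    * (diff_weighted (tau - c^`()) (diff_weighted tau p)).[y].
  rewrite derive1nS derive1E.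
  have dfy := is_derive_on oD Dy (fun t Dt => esym (f1E t Dt))
    (is_derive_weighted (diff_weighted tau p) (weight_div dw) Dy).
  exact: (@derive_val _ _ _ _ _ _ _ dfy).
rewrite f2E f1E // fE // /diff_weighted.
rewrite !(derivD, derivM) !(hornerD, hornerN, hornerM).
have cy := c_neq0 Dy; apply: (mulfI cy).
have := ode y Dy; rewrite derivnS derivn1.
set p2 := p^`()^`().[y]; set p1 := p^`().[y]; set p0 := p.[y].
set t1 := tau^`().[y]; set t0 := tau.[y]; set c1 := c^`().[y]; set d0 := d.[y].
move: cy; set c0 := c.[y] => cy E.
transitivity (w y * (lam * c0 * p0)); last by ring.
by rewrite -E; field.
Qed.

End Weighted.

(** * Differential equations of the seeds and weights of the prefactors *)

Section Seeds.
Variable R : realType.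

Lemma open_domain (s : system R) : open (domain s).
Proof.
case: s => [g|g h] /=; first exact: open_gt.
rewrite (_ : [set y | _] = [set y | -1 < y] `&` [set y | y < 1]).
  by apply: openI; [exact: open_gt|exact: open_lt].
by apply/seteqP; split=> y /=; [move/andP|move=> [-> ->]].
Qed.

Lemma domain01 (s : system R) y : 0 < y < 1 -> domain s y.
Proof. by case: s => [g|g h] /= /andP[y0 y1] //; rewrite y1 andbT; lra. Qed.

Lemma c2_neq0 (s : system R) y : domain s y -> (c2 s).[y] != 0.
Proof.
case: s => [g|g h] /=; first by rewrite hornerX; exact: lt0r_neq0.
move=> /andP[y0 y1]; rewrite hornerD hornerN hornerXn hornerC.
by apply: lt0r_neq0; nra.
Qed.

Local Notation weight_of s := (weight (domain s) (c2 s)).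

Lemma weight_powR (g a : R) : weight_of (Lag g) a%:P (fun y => y `^ a).
Proof.
move=> y /= y0; apply: (is_derive_eq (is_derive1_powR a y0)).
rewrite hornerX hornerC powRB ?(lt0r_neq0 y0) ?implybT // powRr1 ?ltW //.
by rewrite mulrA [a * _]mulrC.
Qed.

Lemma weight_expR (g k : R) :
  weight_of (Lag g) (k *: 'X) (fun y => expR (k * y)).
Proof.
move=> y /= y0.
have dk := is_derive_mull k (is_derive_id y (1 : R)).
apply: (is_derive_eq (is_derive1_comp (is_derive_expR (k * y)) dk)).
by rewrite hornerZ hornerX mulr1 mulrA mulfK ?lt0r_neq0.
Qed.

(* For e other than 1 and -1 the logarithmic derivative, multiplied by
   c = 1 - X^2, is not a polynomial. *)
Lemma weight_powR_affine (g h e a : R) : e ^+ 2 = 1 ->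
  weight_of (Jac g h) ((a * e) *: (1 - e *: 'X)) (fun y => ((1 + e * y) / 2) `^ a).
Proof.
move=> e2 y /= /andP[y0 y1].
have t0 : 0 < (1 + e * y) / 2 by rewrite divr_gt0 //; nra.
have t1 : 1 + e * y != 0 by apply: lt0r_neq0; rewrite divr_gt0 in t0 *; nra.
have dt : is_derive y 1 (fun z => (1 + e * z) / 2) (e / 2).
  apply: (is_derive_eq (is_derive_mul (is_derive_add (is_derive_cst (1 : R) y 1)
    (is_derive_mull e (is_derive_id y (1 : R)))) (is_derive_cst (2^-1 : R) y 1))).
  by rewrite mulr0 addr0 add0r mulr1.
apply: (is_derive_eq (@is_derive1_comp _ (fun t => t `^ a)
  (fun z => (1 + e * z) / 2) _ _ _ (is_derive1_powR a t0) dt)).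
rewrite powRB ?(lt0r_neq0 t0) ?implybT // powRr1 ?ltW //.
move: (_ `^ a) => P.
rewrite hornerZ !(hornerD, hornerN, hornerZ, hornerX, hornerC, hornerXn).
have -> : 1 - y ^+ 2 = (1 + e * y) * (1 - e * y).
  by transitivity (1 - e ^+ 2 * y ^+ 2); [rewrite e2 mul1r|ring].
have t2 : 1 - e * y != 0 by apply: lt0r_neq0; nra.
by field; rewrite t1 t2.
Qed.

Lemma weight_plus (g h a : R) :
  weight_of (Jac g h) (a *: (1 - 'X)) (fun y => ((1 + y) / 2) `^ a).
Proof.
have /(_ g h a) := @weight_powR_affine _ _ 1 _ (expr1n _ 2).
rewrite mulr1 scale1r.
by under eq_fun do rewrite mul1r.
Qed.

Lemma weight_minus (g h a : R) :
  weight_of (Jac g h) (- a *: (1 + 'X)) (fun y => ((1 - y) / 2) `^ a).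
Proof.
have n1 : (-1) ^+ 2 = 1 :> R by rewrite sqrrN expr1n.
have /(_ g h a) := @weight_powR_affine _ _ (-1) _ n1.
rewrite mulrN1 scaleN1r opprK.
by under eq_fun do rewrite mulN1r.
Qed.

Lemma weight_one (s : system R) : weight_of s 0 (fun=> 1).
Proof.
move=> y Dy; apply: (is_derive_eq (is_derive_cst (1 : R) y 1)).
by rewrite horner0 mulr0 mul0r.
Qed.

(** The eigenvalue may stay existential: in Crum's identity those of the seeds cancel, and that of
    the last function multiplies [P], which is evaluated at its zeros. *)
Definition seed_like (s : system R) (f : R -> R) :=
  smooth_on (domain s) f /\ exists lam, solves (domain s) (c2 s) (c1 s) lam f.

Lemma seed_like_weighted s tau w p f : weight_of s tau w ->
    (forall y, domain s y -> f y = w y * p.[y]) ->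
    (exists lam, forall y, domain s y -> (c2 s).[y] ^+ 2 * p^`(2).[y]
      + (c2 s).[y] * (2 * tau.[y] + (c1 s).[y]) * p^`().[y]
      + ((c2 s).[y] * tau^`().[y]
         + (tau.[y] - (c2 s)^`().[y] + (c1 s).[y]) * tau.[y]) * p.[y]
      = lam * (c2 s).[y] * p.[y]) ->
  seed_like s f.
Proof.
move=> dw fE [lam ode]; split.
  by apply: (smooth_weighted (open_domain (s:=s)) (@c2_neq0 s) dw fE).
exists lam; exact: (solves_weighted (open_domain (s:=s)) (@c2_neq0 s) dw fE ode).
Qed.

Let hornerR := (hornerD, hornerN, hornerM, hornerZ, hornerC, hornerX, hornerXn).

Lemma c1LE g y : (c1 (Lag g) : {poly R}).[y] = g + 2^-1 - y.
Proof. by rewrite /= !hornerR. Qed.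

Lemma c1JE g h y : (c1 (Jac g h) : {poly R}).[y] = h - g - (g + h + 1) * y.
Proof. by rewrite /= !hornerR. Qed.

Lemma c2LE g y : (c2 (Lag g) : {poly R}).[y] = y.
Proof. by rewrite /= !hornerR. Qed.

Lemma c2JE g h y : (c2 (Jac g h) : {poly R}).[y] = 1 - y ^+ 2.
Proof. by rewrite /= !hornerR. Qed.

Lemma deriv_c2LE g y : (c2 (Lag g) : {poly R})^`().[y] = 1.
Proof. by rewrite /= derivX hornerC. Qed.

Lemma deriv_c2JE g h y : (c2 (Jac g h) : {poly R})^`().[y] = - 2 * y.
Proof.
rewrite /= derivB derivC derivXn sub0r expr1 hornerN hornerMn hornerX.
by rewrite mulNr mulr_natl.
Qed.

Lemma seed_like_base s n : seed_like s (fun y => (base_poly s n).[y]).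
Proof.
apply: (seed_like_weighted (@weight_one s) (p := base_poly s n)).
  by move=> y _; rewrite mul1r.
case: s => [g|g h].
- exists (- n%:R) => y _; have := laguerre_ode n (g - 2^-1) y.
  rewrite /base_poly; move: (laguerre _ _) => p; cbv zeta => E.
  rewrite c1LE c2LE deriv_c2LE deriv0 horner0.
  transitivity (y * (- n%:R * p.[y])); last by ring.
  by rewrite -E; field.
- exists (- n%:R * (n%:R + (g - 2^-1) + (h - 2^-1) + 1)) => y _.
  have := jacobi_ode n (g - 2^-1) (h - 2^-1) y.
  rewrite /base_poly; move: (jacobi _ _ _) => p; cbv zeta => E.
  rewrite c1JE c2JE deriv_c2JE deriv0 horner0.
  rewrite [RHS]mulrAC -E; by field.
Qed.

(** Conjugation by the weight produces a zeroth-order coefficient that is a constant multiple of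
    [c2]; this constant is added to the classical eigenvalue. The same holds for [muII]. *)
Lemma seed_like_muI s v : seed_like s (muI s v).
Proof.
case: s => [g|g h].
- pose L := laguerre v (g - 2^-1).
  apply: (seed_like_weighted (@weight_expR g 1) (p := L \Po (- 'X))).
    by move=> y _; rewrite mul1r horner_comp hornerN hornerX.
  (* The reflection changes the Laguerre eigenvalue [- v] to [v]; the weight contributes
     [g + 1/2]. *)
  exists (v%:R + g + 2^-1) => y _; have := laguerre_ode v (g - 2^-1) (- y).
  rewrite -/L; cbv zeta => E.
  have dN : (- 'X : {poly R})^`() = - 1 by rewrite derivN derivX.
  have d1 : (L \Po (- 'X))^`() = - (L^`() \Po (- 'X)).
    by rewrite deriv_comp dN mulrN1.
  have d2 : (L \Po (- 'X))^`(2) = L^`(2) \Po (- 'X).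
    by rewrite !derivnS !derivn0 d1 derivN deriv_comp dN mulrN1 opprK.
  rewrite c1LE c2LE deriv_c2LE d2 d1 scale1r derivX hornerC hornerX.
  rewrite !(hornerN, horner_comp, hornerX).
  transitivity (- y * (- v%:R * L.[- y]) + y * (g + 2^-1) * L.[-y]); last by ring.
  by rewrite -E; field.
- pose k := 2^-1 - h; pose p := jacobi v (g - 2^-1) k.
  apply: (seed_like_weighted (@weight_plus g h k) (p := p)) => //.
  exists (- v%:R * (v%:R + (g - 2^-1) + k + 1) - k * (g + 2^-1)) => y _.
  have := jacobi_ode v (g - 2^-1) k y; rewrite -/p; cbv zeta => E.
  rewrite c1JE c2JE deriv_c2JE derivZ derivB derivC derivX !hornerR ?horner0.
  transitivity ((1 - y ^+ 2) * (- v%:R * (v%:R + (g - 2^-1) + k + 1) * p.[y])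
    - k * (g + 2^-1) * (1 - y ^+ 2) * p.[y]); last by ring.
  by rewrite -E /k; field.
Qed.

Lemma seed_like_muII s v : seed_like s (muII s v).
Proof.
case: s => [g|g h].
- pose k := 2^-1 - g; pose p := laguerre v k.
  apply: (seed_like_weighted (@weight_powR g k) (p := p)) => //.
  exists (- v%:R - k) => y _.
  have := laguerre_ode v k y; rewrite -/p; cbv zeta => E.
  rewrite c1LE c2LE deriv_c2LE derivC horner0 hornerC.
  transitivity (y * (- v%:R * p.[y]) - k * y * p.[y]); last by ring.
  by rewrite -E /k; field.
- pose k := 2^-1 - g; pose p := jacobi v k (h - 2^-1).
  apply: (seed_like_weighted (@weight_minus g h k) (p := p)) => //.
  exists (- v%:R * (v%:R + k + (h - 2^-1) + 1) - k * (h + 2^-1)) => y _.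
  have := jacobi_ode v k (h - 2^-1) y; rewrite -/p; cbv zeta => E.
  rewrite c1JE c2JE deriv_c2JE derivZ derivD derivC derivX !hornerR ?horner0.
  transitivity ((1 - y ^+ 2) * (- v%:R * (v%:R + k + (h - 2^-1) + 1) * p.[y])
    - k * (h + 2^-1) * (1 - y ^+ 2) * p.[y]); last by ring.
  by rewrite -E /k; field.
Qed.

Definition prefactor_tau s (dI dII : seq nat) (e : R) : {poly R} :=
  let M : R := (size dI)%:R in
  let N : R := (size dII)%:R in
  match s with
  | Lag g => ((M + g + e) * N)%:P - M *: 'X
  | Jac g h => ((N + h + e) * M) *: (1 - 'X) - ((M + g + e) * N) *: (1 + 'X)
  end.

Lemma weight_prefactor s dI dII e :
  weight_of s (prefactor_tau s dI dII e) (prefactor s dI dII e).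
Proof.
case: s => [g|g h] /=.
  set M := (size dI)%:R; set A := (_ * _).
  have -> : prefactor (Lag g) dI dII e = fun y => y `^ A * expR (- M * y).
    by apply/funext => y; rewrite /= mulNr.
  rewrite -scaleNr.
  exact: (weight_mul (@c2_neq0 (Lag g)) (@weight_powR g A) (@weight_expR g (- M))).
set A := (_ * (size dII)%:R); set B := (_ * (size dI)%:R).
rewrite [X in weight _ _ X]addrC -scaleNr.
exact: (weight_mul (@c2_neq0 (Jac g h)) (@weight_minus g h A) (@weight_plus g h B)).
Qed.

(* The shift of the parameters in C_1 comes from the change of weight. *)
Lemma ode_d_shift s dI dII :
  ode_d (c2 s) (c1 s) (size dI + size dII)
  - (prefactor_tau s dI dII 2^-1 - prefactor_tau s dI dII (- 2^-1)) *+ 2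
  = c1 (shift_params s ((size dI)%:R - (size dII)%:R)
                       ((size dII)%:R - (size dI)%:R)).
Proof.
apply/eqP; rewrite -subr_eq0; apply/eqP/poly_eq0_on01 => y _.
rewrite /ode_d !(hornerD, hornerN, hornerMn); case: s => [g|g h].
  rewrite /shift_params deriv_c2LE !c1LE /= !hornerR.
  by field.
rewrite /shift_params deriv_c2JE !c1JE /= !hornerR.
by field.
Qed.

Lemma c2_deriv3 s : (c2 s : {poly R})^`(3) = 0.
Proof.
case: s => [g|g h]; rewrite !derivnS derivn0 /=.
  by rewrite derivX derivC derivC.
rewrite !(derivB, derivC, derivXn, derivMn, derivX, expr1, sub0r, derivN).
by rewrite mul0rn oppr0.
Qed.

Lemma c1_deriv2 s : (c1 s : {poly R})^`(2) = 0.
Proof.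
case: s => [g|g h]; rewrite !derivnS derivn0 /=.
  by rewrite !(derivB, derivC, derivX) subr0.
by rewrite !(derivB, derivC, derivZ, derivX) scaler0 subr0.
Qed.

End Seeds.

(** * The zeros of the multi-indexed polynomials *)

Section RootFactor.
Variables (F : comNzRingType) (r : {poly F}) (a : F).

Lemma deriv_root_factor : (('X - a%:P) * r)^`().[a] = r.[a].
Proof.
by rewrite derivM derivXsubC mul1r hornerD hornerM hornerXsubC subrr mul0r addr0.
Qed.

Lemma deriv2_root_factor : (('X - a%:P) * r)^`(2).[a] = r^`().[a] *+ 2.
Proof.
rewrite !derivnS derivn0 derivM derivXsubC mul1r derivD derivM derivXsubC mul1r.
by rewrite !hornerD hornerM hornerXsubC subrr mul0r addr0.
Qed.

End RootFactor.

Section Zeros.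
Variable R : realType.
Local Notation C := R[i].
Local Notation toC := (map_poly (real_complex R)).

(** The default value is 0, so a nonzero value certifies that an agreeing polynomial exists. *)
Lemma poly_ofP (A : set R) (f : R -> R) : poly_of A f != 0 ->
  forall y, A y -> (poly_of A f).[y] = f y.
Proof. by rewrite /poly_of; case: xgetP => [p -> //|_]; rewrite eqxx. Qed.

(** At a zero of [P] the terms of [crum_poly] containing [P] undifferentiated vanish. The rest is
    [c^2] times the stated relation, the weights being absorbed into [C1] by [ode_d_shift]. *)
Lemma zero_ode s dI dII n0 (z : C) :
    (0 < size dI + size dII)%N ->
    multi_poly s dI dII n0 != 0 -> Xi s dI dII != 0 ->
    root (toC (multi_poly s dI dII n0)) z -> (toC (c2 s)).[z] != 0 ->
  let P := toC (multi_poly s dI dII n0) in let X := toC (Xi s dI dII) in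
  let c := (toC (c2 s)).[z] in
  let C1 := (toC (c1 (shift_params s ((size dI)%:R - (size dII)%:R)
                                     ((size dII)%:R - (size dI)%:R)))).[z] in
  c * P^`(2).[z] * X.[z] + (C1 * X.[z] - 2 * c * X^`().[z]) * P^`().[z] = 0.
Proof.
move=> r_gt0 P_neq0 X_neq0.
have PE := poly_ofP P_neq0; have XE := poly_ofP X_neq0.
rewrite -/(multi_poly s dI dII n0) in PE; rewrite -/(Xi s dI dII) in XE.
move: PE XE; set P := multi_poly _ _ _ _; set X := Xi _ _ _ => PE XE.
pose fs := seeds s dI dII.
have size_fs : size fs = (size dI + size dII).-1.+1.
  by rewrite size_cat !size_map prednK.
have seed_fs j : (j < (size dI + size dII).-1.+1)%N ->
    seed_like s (nth (fun=> 0) fs j).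
  rewrite -size_fs size_cat !size_map nth_cat size_map => lt_j.
  case: ltnP => [lt_jI|le_Ij]; rewrite (nth_map 0%N) //; last by lia.
    exact: seed_like_muI.
  exact: seed_like_muII.
have [lam lamP] : exists lam : nat -> R,
    forall j, (j < (size dI + size dII).-1.+1)%N ->
      solves (domain s) (c2 s) (c1 s) (lam j) (nth (fun=> 0) fs j).
  (* Eigenvalues are made total, with value 0 out of range, before a choice function is taken. *)
  have : forall j, exists l, (j < (size dI + size dII).-1.+1)%N ->
      solves (domain s) (c2 s) (c1 s) l (nth (fun=> 0) fs j).
    move=> j; case: ltnP => [/seed_fs[_ [l lP]]|_]; last by exists 0.
    by exists l => _; exact: lP.
  by move=> /choice[lam lamP]; exists lam.
have [sphi [lphi ophi]] := seed_like_base s n0.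
have := crum_poly (open_domain (s:=s)) (@domain01 R s) (c2_deriv3 s) (c1_deriv2 s)
  (@c2_neq0 R s) size_fs (fun j lt_j => (seed_fs j lt_j).1) sphi lamP ophi
  (@weight_prefactor _ s dI dII 2^-1) (@weight_prefactor _ s dI dII (- 2^-1)) PE XE.
rewrite prednK // -(ode_d_shift s dI dII).
set tU := prefactor_tau _ _ _ _; set tW := prefactor_tau _ _ _ _.
set a := ode_d _ _ (size dI + size dII).
clearbody tU tW a; move: (ode_b _ _ _ - _) => b; move: (ode_d _ _ _) => a'.
move: (c2 s) => c.
cbv zeta; rewrite rootE => id /eqP P0 c_neq0.
pose ev p := (toC p).[z].
have evD p q : ev (p + q) = ev p + ev q by rewrite /ev rmorphD hornerD.
have evN p : ev (- p) = - ev p by rewrite /ev rmorphN hornerN.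
have evM p q : ev (p * q) = ev p * ev q by rewrite /ev rmorphM hornerM.
have evMn p n : ev (p *+ n) = ev p *+ n by rewrite /ev rmorphMn hornerMn.
have ev1 p : (toC p)^`().[z] = ev p^`() by rewrite deriv_map.
have ev2 p : (toC p)^`(2).[z] = ev p^`()^`() by rewrite /ev -!deriv_map.
rewrite ev2 !ev1 -/(ev c) -/(ev X) -/(ev (_ - _)).
have ev0 : ev 0 = 0 by rewrite /ev rmorph0 horner0.
have {id} : ev _ = ev 0 := congr1 ev id.
rewrite -/(ev P) in P0; rewrite -/(ev c) in c_neq0.
clearbody ev; rewrite ev0.
rewrite /deriv_num expr2 !(derivB, derivD, derivM) !(evD, evN, evM, evMn) P0.
move: (ev c) (ev X) (ev tU) (ev tW) (ev a) c_neq0 => c0 x0 u0 w0 a0 c0_neq0 id.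
apply: (mulfI (expf_neq0 2 c0_neq0)); rewrite mulr0; apply: etrans id.
by ring.
Qed.

Lemma c2_neq0_regular s dI dII n0 (eta : 'I_(ell dI dII + n0) -> C) n :
  regular s eta -> (toC (c2 s)).[eta n] != 0.
Proof.
case: s => [g|g h] [_ _ _ /(_ n) etaN _]; rewrite /c2.
  by rewrite map_polyX hornerX.
move: etaN => /andP[n1 nN1]; rewrite rmorphB rmorph1 rmorphXn /= map_polyX.
rewrite hornerD hornerN hornerXn hornerC subr_eq0 eq_sym sqrf_eq1.
by rewrite negb_or n1.
Qed.

(** For [n != m] the product defining column [m] vanishes at [eta n], which removes the energy and
    the zeroth-order part of the operator. [zero_ode] then eliminates the first-order
    coefficient. *)
Lemma Mtilde_offdiag s dI dII n0 (eta : 'I_(ell dI dII + n0) -> C) n m :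
    (0 < size dI + size dII)%N -> regular s eta -> n != m ->
  Mtilde s eta n m = 8 * (toC (c2 s)).[eta n] / (eta n - eta m) ^+ 2.
Proof.
move=> r_gt0 reg nm; have c_neq0 := c2_neq0_regular n reg.
case: reg => sizeP PE inj_eta _ Xroot.
set z := eta n in c_neq0 *.
have P_neq0 : multi_poly s dI dII n0 != 0 by rewrite -size_poly_eq0 sizeP.
have X0_neq0 : (toC (Xi s dI dII)).[z] != 0 by exact: Xroot.
have X_neq0 : Xi s dI dII != 0.
  by apply: contraNneq X0_neq0 => ->; rewrite map_poly0 horner0.
have lc_neq0 : real_complex R (lead_coef (multi_poly s dI dII n0)) != 0.
  by rewrite fmorph_eq0 lead_coef_eq0.
pose q : {poly C} := \prod_(j | (j != n) && (j != m)) ('X - (eta j)%:P).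
have QE : \prod_j ('X - (eta j)%:P) = ('X - z%:P) * (('X - (eta m)%:P) * q).
  by rewrite (bigD1 n) //= (bigD1 m) 1?eq_sym.
have pE : \prod_(j | j != m) ('X - (eta j)%:P) = ('X - z%:P) * q.
  by rewrite (bigD1 n) //=; congr (_ * _); apply: eq_bigl => j; rewrite andbC.
have qE : q.[z] = \prod_(j | (j != n) && (j != m)) (z - eta j).
  by rewrite horner_prod; apply: eq_bigr => j _; rewrite hornerXsubC.
have denE : \prod_(j | j != n) (z - eta j) = (z - eta m) * q.[z].
  by rewrite (bigD1 m) 1?eq_sym //= qE.
have q_neq0 : q.[z] != 0.
  rewrite qE; apply/prodf_neq0 => j /andP[jn _].
  by rewrite subr_eq0; apply: contra_neq jn => /inj_eta.
have D_neq0 : z - eta m != 0.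
  by rewrite subr_eq0; apply: contra_neq nm => /inj_eta.
have Proot : root (toC (multi_poly s dI dII n0)) z.
  by rewrite rootE PE QE hornerZ hornerM hornerXsubC subrr mul0r mulr0.
have := zero_ode r_gt0 P_neq0 X_neq0 Proot c_neq0.
rewrite mxE pE /Htilde; cbv zeta.
rewrite denE PE QE.
rewrite derivnZ derivZ 2!hornerZ !deriv_root_factor !deriv2_root_factor.
rewrite derivM derivXsubC mul1r hornerD !hornerM !hornerXsubC subrr mul0r.
move: (real_complex R (lead_coef _)) lc_neq0 => lc lc_neq0.
move: (toC (Xi _ _ _)).[z] X0_neq0 => X0 X0_neq0.
move: (toC (Xi _ _ _))^`().[z] (toC (Xi _ _ _))^`(2).[z] => X1 X2.
move: (toC (c1 _)).[z] (toC (c1 _)).[z] (toC (c2 s)).[z] c_neq0 => C1m C1 c c_neq0.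
move: q.[z] q^`().[z] q_neq0 (z - eta m) D_neq0 => q0 q1 q0_neq0 D D_neq0 E.
(* This is [zero_ode] with [P' = lc D q0] and [P'' = 2 lc (q0 + D q1)] at [z], divided by [lc]. *)
have key : (C1 * X0 - 2 * c * X1) * (D * q0) = - (2 * c * (q0 + D * q1) * X0).
  by apply: (mulfI lc_neq0); apply/eqP; rewrite -subr_eq0 -E; apply/eqP; ring.
transitivity (-4 * (2 * c * q1 * X0 * D + (C1 * X0 - 2 * c * X1) * (D * q0))
    / (X0 * D ^+ 2 * q0)); first by field; rewrite X0_neq0 D_neq0 q0_neq0.
by rewrite key; field; rewrite X0_neq0 D_neq0 q0_neq0.
Qed.

Lemma Mmx_sym s dI dII n0 (eta x : 'I_(ell dI dII + n0) -> C) :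
    (0 < size dI + size dII)%N -> regular s eta ->
    (forall n, sinusoidal_dot s (x n) ^+ 2 = 4 * (toC (c2 s)).[eta n]) ->
  (Mmx s eta x)^T = Mmx s eta x.
Proof.
move=> r_gt0 reg dot2; apply/matrixP => n m; rewrite mxE.
have [->//|nm] := eqVneq n m.
have mn : m != n by rewrite eq_sym.
rewrite [LHS]mxE [RHS]mxE !Mtilde_offdiag //.
have dot_neq0 k : sinusoidal_dot s (x k) != 0.
  by rewrite -sqrf_eq0 dot2 mulf_neq0 ?pnatr_eq0 // c2_neq0_regular.
have c2E k : (toC (c2 s)).[eta k] = sinusoidal_dot s (x k) ^+ 2 / 4.
  by rewrite dot2 mulrC mulKf ?pnatr_eq0.
have D_neq0 : eta n - eta m != 0.
  case: reg => _ _ inj_eta _ _.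
  by rewrite subr_eq0; apply: contra_neq nm => /inj_eta.
rewrite !c2E -[eta m - eta n]opprB sqrrN.
move: (eta n - eta m) D_neq0 (dot_neq0 n) (dot_neq0 m) => D D0.
move: (sinusoidal_dot s (x n)) (sinusoidal_dot s (x m)) => a b a0 b0.
by field; rewrite a0 b0 D0.
Qed.

End Zeros.

(** The form involves no conjugation, so plain transposition moves [A] from [v] to [w], over any
    field. *)
Lemma bilin_eigen_sym (F : fieldType) n (A : 'M[F]_n) v w alpha beta :
    A^T = A -> A *m v = alpha *: v -> A *m w = beta *: w -> alpha != beta ->
  bilin v w = 0.
Proof.
move=> symA Av Aw ab.
have bilinE (a b : 'cV[F]_n) : bilin a b = (a^T *m b) 0 0.
  by rewrite mxE; apply: eq_bigr => i _; rewrite mxE.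
have : (A *m v)^T *m w = v^T *m (A *m w) by rewrite trmx_mul symA mulmxA.
rewrite Av Aw linearZ /= -scalemxAr -scalemxAl => /matrixP/(_ 0 0).
rewrite mxE [RHS]mxE -!bilinE => /eqP; rewrite -subr_eq0 -mulrBl mulf_eq0.
by rewrite subr_eq0 (negPf ab) => /eqP.
Qed.

(** * The complex derivative of the sinusoidal coordinate *)

Section ComplexExponential.
Variable R : realType.
Local Notation C := R[i].
Implicit Types (u v z k : C).
Local Open Scope complex_scope.

Lemma is_derive0_linear (f : R -> R) d : is_derive (0 : R) 1 f d ->
  forall e, 0 < e -> exists2 r, 0 < r &
    forall x, `|x| < r -> `|f x - f 0 - d * x| <= e * `|x|.
Proof.
move=> df e e0.
have /cvgrPdist_lt/(_ _ e0) : h^-1 *: (f (h *: 1 + 0) - f 0) @[h --> 0^'] --> d.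
  have [dv <-] := df; exact: dv.
move=> [r /= r0 H]; exists r => // x xr.
have [->|x0] := eqVneq x 0; first by rewrite subrr mulr0 subr0 normr0 mulr0.
have := H x; rewrite /ball_ /= sub0r normrN => /(_ xr x0) /ltW.
rewrite addr0 [_ *: 1]mulr1 => le_e.
have -> : f x - f 0 - d * x = - (x * (d - x^-1 *: (f x - f 0))).
  by rewrite mulrBr [x * (_ *: _)]mulrA mulfV // mul1r opprB [d * x]mulrC.
by rewrite normrN normrM mulrC ler_wpM2r.
Qed.

Lemma normc_leD (x y : R) : normc (x +i* y) <= `|x| + `|y|.
Proof.
rewrite /normc -[leRHS]ger0_norm ?addr_ge0 // -sqrtr_sqr ler_wsqrtr //.
rewrite sqrrD !real_normK ?num_real // lerD2r lerDl.
by rewrite mulrn_wge0 // mulr_ge0.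
Qed.

Lemma normc_geRe (x y : R) : `|x| <= normc (x +i* y).
Proof. by rewrite /normc -sqrtr_sqr ler_wsqrtr // lerDl sqr_ge0. Qed.

Lemma normc_geIm (x y : R) : `|y| <= normc (x +i* y).
Proof. by rewrite /normc -sqrtr_sqr ler_wsqrtr // lerDr sqr_ge0. Qed.

(** Complex differentiability at 0, assembled from the real derivatives of [expR], [sin] and [cos]
    at 0. *)
Lemma cexp_near0 e : 0 < e ->
  exists2 r, 0 < r &
    forall u, normc u < r -> normc (cexp u - 1 - u) <= e * normc u.
Proof.
move=> e0.
(* The 8 adds up the bounds below: [t |a| + 2 t |b|] for the real part and [5 t |b|] for the
   imaginary part. *)
pose t := Num.min 1 (e / 8); have t0 : 0 < t by rewrite lt_min ltr01 divr_gt0.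
have t1 : t <= 1 by rewrite ge_min lexx.
have te : 8 * t <= e by rewrite -ler_pdivlMl // mulrC ge_min lexx orbT.
clearbody t; have dexp := is_derive_expR (0 : R); rewrite expR0 in dexp.
have dsin := is_derive_sin (0 : R); rewrite cos0 in dsin.
have dcos := is_derive_cos (0 : R); rewrite sin0 oppr0 in dcos.
have [r1 r1_gt0 Hexp] := is_derive0_linear dexp t0.
have [r2 r2_gt0 Hsin] := is_derive0_linear dsin t0.
have [r3 r3_gt0 Hcos] := is_derive0_linear dcos t0.
exists (Num.min t (Num.min r1 (Num.min r2 r3))).
  by rewrite !lt_min t0 r1_gt0 r2_gt0 r3_gt0.
case=> a b; rewrite !lt_min => /and4P[ut u1 u2 u3].
have la := normc_geRe a b; have lb := normc_geIm a b.
have {Hexp} := Hexp a (le_lt_trans la u1).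
have {Hsin} := Hsin b (le_lt_trans lb u2).
have {Hcos} := Hcos b (le_lt_trans lb u3).
rewrite expR0 sin0 cos0 subr0 mul0r subr0 !mul1r => Hcos Hsin Hexp.
have at1 := le_lt_trans la ut; have bt1 := le_lt_trans lb ut.
have cos1 := cos_max b.
have -> : cexp (a +i* b) - 1 - (a +i* b)
    = (expR a * cos b - 1 - a) +i* (expR a * sin b - b).
  by rewrite /cexp /=; simpc.
apply: le_trans (normc_leD _ _) _.
have re_le : `|expR a * cos b - 1 - a| <= t * `|a| + 2 * t * `|b|.
  have -> : expR a * cos b - 1 - a
    = (expR a - 1 - a) * cos b + (1 + a) * (cos b - 1) by ring.
  apply: le_trans (ler_normD _ _) _; rewrite !normrM; apply: lerD.
    by rewrite -[leRHS]mulr1 ler_pM.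
  rewrite -mulrA ler_pM //; apply: le_trans (ler_normD _ _) _.
  by rewrite normr1; lra.
have im_le : `|expR a * sin b - b| <= 5 * t * `|b|.
  have -> : expR a * sin b - b = (expR a - 1) * sin b + (sin b - b) by ring.
  have e1 : `|expR a - 1| <= 2 * t.
    have -> : expR a - 1 = (expR a - 1 - a) + a by ring.
    by apply: le_trans (ler_normD _ _) _; nra.
  have s1 : `|sin b| <= 2 * `|b|.
    have -> : sin b = (sin b - b) + b by ring.
    by apply: le_trans (ler_normD _ _) _; have := normr_ge0 b; nra.
  apply: le_trans (ler_normD _ _) _; rewrite normrM.
  have := ler_pM (normr_ge0 _) (normr_ge0 _) e1 s1; lra.
have := normr_ge0 a; have := normr_ge0 b; nra.
Qed.

Lemma cexpD u v : cexp (u + v) = cexp u * cexp v.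
Proof.
case: u => a b; case: v => c d; rewrite /cexp /= expRD cosD sinD.
by simpc; congr (_ +i* _); ring.
Qed.

Lemma cexp0 : cexp 0 = 1 :> C.
Proof. by rewrite /cexp /= expR0 cos0 sin0; simpc. Qed.

(** The addition formula reduces the difference quotient at [z] to the estimate at 0, applied to
    [k * t]. *)
Lemma is_derive_cexp k z :
  is_derive (z : C^o) (1 : C^o) (fun w : C^o => cexp (k * w) : C^o)
    (k * cexp (k * z)).
Proof.
suff H : (fun h : C =>
      h^-1 *: (((fun w : C^o => cexp (k * w) : C^o) \o shift (z : C^o))
                 (h *: (1 : C^o)) - cexp (k * z)))
    @ (@dnbhs C^o 0)
    --> (k * cexp (k * z) : C^o).
  apply: DeriveDef; last exact: cvg_lim H.
  by apply/cvg_ex; exists (k * cexp (k * z)).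
apply/cvgrPdist_lt => /= e e0.
have [er er0 eE] : exists2 er, 0 < er & e = er%:C.
  by move: e0; case: (e) => a b; rewrite ltcE /= => /andP[/eqP-> a0]; exists a.
have nonneg u : 0 <= normc u by case: u => a b; exact: sqrtr_ge0.
have normE u : `|u| = (normc u)%:C by [].
set E := cexp (k * z).
(* The summand 1 keeps the denominator positive for [k = 0] and makes the final estimate strict. *)
have d0 : 0 < er / (normc E * normc k + 1).
  by rewrite divr_gt0 // ltr_wpDl // mulr_ge0.
have [r r0 Hr] := cexp_near0 d0.
near=> t.
have t0 : t != 0 by near: t; exact: (@nbhs_dnbhs_neq C^o 0).
have : `|t| < (r / (normc k + 1))%:C.
  near: t; apply: (@dnbhs0_lt C C^o); rewrite ltcR divr_gt0 //.
  by rewrite ltr_wpDl.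
rewrite normE ltcR ltr_pdivlMr ?ltr_wpDl // => t_lt.
have tA : k * (t *: (1 : C^o) + z) = k * t + k * z.
  by rewrite mulrDr; congr (k * _ + _); exact: mulr1.
rewrite tA cexpD -/E.
have -> : k * E - t^-1 *: (cexp (k * t) * E - E : C^o)
    = - (t^-1 * (E * (cexp (k * t) - 1 - k * t))).
  have -> : t^-1 *: (cexp (k * t) * E - E : C^o)
    = t^-1 * (cexp (k * t) * E - E) by [].
  by field.
have nt0 : 0 < normc t.
  by rewrite lt_neqAle nonneg andbT eq_sym; apply: contra_neq t0 => /eq0_normc.
have kt : normc (k * t) < r by rewrite normcM; have := nonneg t; nra.
have := Hr _ kt; clearbody E; rewrite normrN normE eE ltcR.
move: (cexp (k * t) - 1 - k * t) => w; rewrite !normcM normcV => w_le.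
rewrite mulrC ltr_pdivrMr //.
apply: le_lt_trans (ler_wpM2l (nonneg E) w_le) _.
have -> : normc E * (er / (normc E * normc k + 1) * (normc k * normc t))
    = er * normc t * (normc E * normc k / (normc E * normc k + 1)) by ring.
rewrite gtr_pMr ?mulr_gt0 // ltr_pdivrMr ?ltr_wpDl ?mulr_ge0 //.
by rewrite mul1r ltrDl.
Unshelve. all: by end_near.
Qed.

(** In the Jacobi case this is [sin^2 + cos^2 = 1] in exponential form: [E E' = 1] gives
    [(E - E')^2 = (E + E')^2 - 4], and [k^2 = -4]. *)
Lemma sinusoidal_dot_sq (s : system R) x :
  sinusoidal_dot s x ^+ 2
  = 4 * (map_poly (real_complex R) (c2 s)).[sinusoidal s x].
Proof.
case: s => [g|g h] /=.
  have -> : sinusoidal_dot (Lag g) x = 2 * x.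
    rewrite /sinusoidal_dot derive1E.
    have dx : is_derive (x : C^o) (1 : C^o) (fun w : C^o => w ^+ 2 : C^o) (2 * x).
      have dX := @is_deriveX C C^o id 2 x 1 1 (is_derive_id _ _).
      by apply: (is_derive_eq dX); rewrite expr1; exact: mulr1.
    exact: (@derive_val _ _ _ _ _ _ _ dx).
  by rewrite map_polyX hornerX; ring.
pose k : C := 'i * 2; pose E := cexp (k * x); pose E' := cexp (- k * x).
have EE' : E * E' = 1 by rewrite -cexpD mulNr subrr cexp0.
have sinE w : ccos (2 * w) = (cexp (k * w) + cexp (- k * w)) / 2.
  by rewrite /ccos mulNr /k mulrA.
have -> : sinusoidal_dot (Jac g h) x = (k * E - k * E') / 2.
  rewrite /sinusoidal_dot derive1E.
  have dx : is_derive (x : C^o) (1 : C^o) (fun w : C^o => ccos (2 * w) : C^o)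
      ((k * E - k * E') / 2).
    have -> : (fun w : C^o => ccos (2 * w) : C^o)
        = 2^-1 *: ((fun w : C^o => cexp (k * w) : C^o)
                    + (fun w : C^o => cexp (- k * w) : C^o)).
      by apply/funext => w; rewrite sinE mulrC.
    apply: (is_derive_eq (is_deriveZ _ (is_deriveD (is_derive_cexp k x)
       (is_derive_cexp (- k) x)))).
    by transitivity (2^-1 * (k * E + - k * E')); [|rewrite mulrC mulNr].
  exact: (@derive_val _ _ _ _ _ _ _ dx).
rewrite rmorphB rmorph1 rmorphXn /= map_polyX hornerD hornerN hornerXn hornerC.
rewrite sinE -/E -/E'.
have k2 : k ^+ 2 = - 4 by rewrite exprMn sqr_i; ring.
transitivity (k ^+ 2 / 4 * ((E + E') ^+ 2 - 4 * (E * E'))); first by field.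
by rewrite k2 EE'; field.
Qed.

End ComplexExponential.

Theorem theorem4p1 (R : realType) (s : system R) (dI dII : seq nat) (n0 : nat)
  (eta x : 'I_(ell dI dII + n0) -> R[i])
  (bar : 'I_(ell dI dII + n0) -> 'I_(ell dI dII + n0))
  (hD : multi_index dI dII) (hpar : admissible s dI dII) (hn0 : (1 <= n0)%N)
  (hP : regular s eta)
  (hx : forall n, sinusoidal s (x n) = eta n)
  (hbar : involutive bar /\ forall n, eta (bar n) = conjc (eta n))
  (v w : 'cV[R[i]]_(ell dI dII + n0)) (alpha beta : R[i])
  (hv : Vspace s x bar v) (hw : Vspace s x bar w)
  (hMv : Mmx s eta x *m v = alpha *: v)
  (hMw : Mmx s eta x *m w = beta *: w)
  (hab : alpha != beta) :
  bilin v w = 0.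
Proof.
have r_gt0 : (0 < size dI + size dII)%N by case: hD.
apply: (bilin_eigen_sym _ hMv hMw hab).
apply: (Mmx_sym r_gt0 hP) => n; rewrite sinusoidal_dot_sq.
by rewrite hx.
Qed.
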